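(* Let $m,n\ge 1$, $d=mn$, and let $f:\mathbb{R}^{m\times n}\to\mathbb{R}$ be differentiable, bounded below, and $L$-smooth with $L>0$: $\|\nabla f(W)-\nabla f(W')\|_F\le L\|W-W'\|_F$ for all $W,W'\in\mathbb{R}^{m\times n}$. Assume the stochastic gradient $\nabla f(W;\xi)$ satisfies, for all $W$, $\mathbb{E}[\nabla f(W;\xi)]=\nabla f(W)$ and $\mathbb{E}\|\nabla f(W;\xi)-\nabla f(W)\|_F^2\le\sigma^2$. Let $r,p$ be integers with $r\ge 2$, $p\ge 2$, $r+p\le\min\{m,n\}$, and put $\gamma=\left(1+\frac{r}{p-1}\right)^{1/2}$. Let $(W_t)_{t\ge1}$ be generated by the MLorc-Lion algorithm (defined in the context) with initial point $W_1$, step size $\alpha>0$, batch size $b\ge 1$, target rank $r$, oversampling parameter $p$, and parameters $0\le\beta_1\le\frac{1}{4\gamma\sqrt d}$ and $\beta_2\in[0,1)$. (i) There is an absolute constant $C>0$ such that for every $T\ge1$, $$\frac1T\sum_{t=1}^T\mathbb{E}\big[\|\nabla f(W_t)\|_{1,1}\big]\le C\Bigg[\frac{\mathbb{E}[f(W_1)-f(W_{T+1})]}{\alpha T}+\frac{\sigma\sqrt d}{\sqrt b\,T(1-\beta_2)}+\frac{2L\alpha\beta_1 d}{1-\beta_2}+dL\alpha+\gamma\frac{\sigma\sqrt d}{\sqrt b}+\big(|\beta_1-\beta_2|+1-\beta_1\big)\frac{\sqrt d\,\sigma}{\sqrt{b(1-\beta_2)}}\Bigg].$$ (ii) Let $\Delta=f(W_1)-\inf_W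 f(W)$, and suppose $\Delta>0$. If $\gamma=O(1)$, $\beta_2$ is a constant with $\frac1{1-\beta_2}=O(1)$, and $\alpha=\sqrt{\frac{\Delta}{LdT}}$, then $$\frac1T\sum_{t=1}^T\mathbb{E}\big[\|\nabla f(W_t)\|_{1,1}\big]\le O(1)\left[\frac{\sqrt{dL\Delta}}{\sqrt T}+\frac{\sigma\sqrt d}{\sqrt b}\right],$$ where the $O(1)$ factor depends only on the upper bounds for $\gamma$ and $\frac{1}{1-\beta_2}$.
   Context: Norms: for $A\in\mathbb{R}^{m\times n}$, $\|A\|_F$ is the Frobenius norm and $\|A\|_{1,1}=\sum_{i,j}|A_{ij}|$. For a batch $B=\{\xi^i\}_{i=1}^b$, $\nabla f(W;B)=\frac1b\sum_{i=1}^b\nabla f(W;\xi^i)$. $\mathrm{sign}$ is applied entrywise, with $\mathrm{sign}(0)=0$. Randomized SVD, $\mathrm{RSVD}(A,r,p)$, for $A\in\mathbb{R}^{m\times n}$, target rank $r$, oversampling parameter $p$, $l=r+p$: draw a random matrix $\Omega\in\mathbb{R}^{n\times l}$ with i.i.d. standard Gaussian entries, independent of everything else; set $Y=A\Omega$; compute a QR decomposition $Y=QR$ with $Q\in\mathbb{R}^{m\times l}$ having orthonormal columns; set $B=Q^\top A\in\mathbb{R}^{l\times n}$; compute an SVD of $B$ and keep its $r$ leading singular triplets, $\tilde U\in\mathbb{R}^{l\times r}$, $\Sigma\in\mathbb{R}^{r\times r}$, $V\in\mathbb{R}^{n\times r}$; output $(U,\Sigma,V)$ with $U=Q\tilde U$.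 Thus $U\Sigma V^\top$ is a rank-at-most-$r$ approximation of $A$. MLorc-Lion algorithm: given $W_1$, $\alpha$, $\beta_1,\beta_2$, $r$, $p$, $b$, start from $\tilde m_0=0$ (zero RSVD factors). For $t=1,2,\dots$: draw a mini-batch $B_t=\{\xi_t^i\}_{i=1}^b$ of i.i.d. samples, independent of the past; set $g_t=\nabla f(W_t;B_t)$, $c_t=\beta_1\tilde m_{t-1}+(1-\beta_1)g_t$, $m_t=\beta_2\tilde m_{t-1}+(1-\beta_2)g_t$, $(m_{u,t},m_{s,t},m_{v,t})=\mathrm{RSVD}(m_t,r,p)$ (with fresh randomness), $\tilde m_t=m_{u,t}m_{s,t}m_{v,t}^\top$, $W_{t+1}=W_t-\alpha\,\mathrm{sign}(c_t)$. Expectations are over all randomness (mini-batches and RSVD). *)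

(* Defs.v *)
From HB Require Import structures.
From mathcomp Require Import all_boot all_order all_algebra.
From mathcomp Require Import all_classical all_reals all_analysis.

Set Implicit Arguments.
Unset Strict Implicit.
Unset Printing Implicit Defensive.

Import Order.TTheory GRing.Theory Num.Theory.
Import numFieldNormedType.Exports.

Local Open Scope classical_set_scope.
Local Open Scope ring_scope.

(* Matrices carry the product sigma-algebra, i.e. the one generated by the
   entries; over R this is the Borel sigma-algebra of R^(m x n). *)
Section measurable_matrix.
Context {d} {T : measurableType d} (m n : nat).

Definition mx_measurable : set (set 'M[T]_(m, n)) :=
  <<s \bigcup_(ij in [set: 'I_m * 'I_n])
        preimage_set_system setT (fun A : 'M[T]_(m, n) => A ij.1 ij.2)
          measurable >>.

Let mx_set0 : mx_measurable set0.
Proof. exact: sigma_algebra0. Qed.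

Let mx_setC A : mx_measurable A -> mx_measurable (~` A).
Proof. exact: sigma_algebraC. Qed.

Let mx_bigcup (F : (set 'M[T]_(m, n))^nat) :
  (forall i, mx_measurable (F i)) -> mx_measurable (\bigcup_i F i).
Proof. exact: sigma_algebra_bigcup. Qed.

HB.instance Definition _ := @isMeasurable.Build (measure_tuple_display d)
  'M[T]_(m, n) mx_measurable mx_set0 mx_setC mx_bigcup.

End measurable_matrix.

Section matrices.
Context {R : realType}.

Definition frobenius_norm m n (A : 'M[R]_(m, n)) : R :=
  Num.sqrt (\sum_(i < m) \sum_(j < n) A i j ^+ 2).

Definition norm11 m n (A : 'M[R]_(m, n)) : R :=
  \sum_(i < m) \sum_(j < n) `|A i j|.

Definition sign_mx m n (A : 'M[R]_(m, n)) : 'M[R]_(m, n) := map_mx Num.sg A.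

Definition grad m n (f : 'M[R]_(m, n) -> R) (W : 'M[R]_(m, n)) : 'M[R]_(m, n) :=
  \matrix_(i < m, j < n) 'D_(delta_mx i j) f W.

Definition orthonormal_columns m l (Q : 'M[R]_(m, l)) : Prop :=
  Q^T *m Q = 1%:M.

Definition is_QR m l (Y Q : 'M[R]_(m, l)) (T : 'M[R]_l) : Prop :=
  [/\ orthonormal_columns Q,
      forall i j : 'I_l, (j < i)%N -> T i j = 0
    & Y = Q *m T].

(* Thin singular value decomposition B = U diag(s) V^T of a wide matrix, the
   triplets being sorted by nonincreasing singular value. *)
Definition is_SVD l n (B : 'M[R]_(l, n))
    (U : 'M[R]_l) (s : 'rV[R]_l) (V : 'M[R]_(n, l)) : Prop :=
  [/\ orthonormal_columns U, orthonormal_columns V,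
      forall i, 0 <= s ord0 i,
      forall i j : 'I_l, (i <= j)%N -> s ord0 j <= s ord0 i
    & B = U *m diag_mx s *m V^T].

(* (U, S, V) is a possible output of RSVD(A, r, p) when the Gaussian test matrix
   takes the value Om. The QR and singular value decompositions are not unique,
   hence a relation; lsubmx keeps the first r of the r + p triplets. *)
Definition is_RSVD m n r p (A : 'M[R]_(m, n)) (Om : 'M[R]_(n, r + p))
    (U : 'M[R]_(m, r)) (S : 'M[R]_r) (V : 'M[R]_(n, r)) : Prop :=
  exists (Q : 'M[R]_(m, r + p)) (T : 'M[R]_(r + p))
         (UB : 'M[R]_(r + p)) (s : 'rV[R]_(r + p)) (VB : 'M[R]_(n, r + p)),
    [/\ is_QR (A *m Om) Q T,
        is_SVD (Q^T *m A) UB s VB,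
        U = Q *m lsubmx UB,
        S = diag_mx (lsubmx s)
      & V = lsubmx VB].

Definition rsvd_gamma (r p : nat) : R := Num.sqrt (1 + r%:R / (p%:R - 1)).

End matrices.

Section independence.
Context {d} {T : measurableType d} {R : realType} (P : probability T R).
Local Open Scope ereal_scope.

Definition sigma_of d' (S : measurableType d') (X : T -> S) : set (set T) :=
  preimage_set_system setT X measurable.

Definition independent_systems (F G : set (set T)) : Prop :=
  forall A B, F A -> G B -> P (A `&` B) = P A * P B.

Definition mutually_independent d' (S : measurableType d') (I : finType)
    (X : I -> T -> S) : Prop :=
  forall (J : {set I}) (A : I -> set S), (forall i, measurable (A i)) ->
    P (\bigcap_(i in [set` J]) X i @^-1` A i) =
    \prod_(i in J) P (X i @^-1` A i).

Definition iid_with_law d' (S : measurableType d') (mu : probability S R)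
    (I : finType) (X : I -> T -> S) : Prop :=
  [/\ forall i, measurable_fun setT (X i),
      forall i A, measurable A -> P (X i @^-1` A) = mu A
    & mutually_independent X].

End independence.

Section optimization.
Context {R : realType}.

Record smooth_bounded_below m n (f : 'M[R]_(m, n) -> R) (L : R) : Prop := {
  sbb_differentiable : forall W, differentiable f W;
  sbb_bounded_below : has_lbound (range f);
  sbb_smooth : forall W W' : 'M[R]_(m, n),
    frobenius_norm (grad f W - grad f W') <= L * frobenius_norm (W - W')
}.

(* G W x stands for the stochastic gradient of f at W for the sample x, whose
   law is D. *)
Record stochastic_gradient m n (f : 'M[R]_(m, n) -> R)
    dX (X : measurableType dX) (D : probability X R)
    (G : 'M[R]_(m, n) -> X -> 'M[R]_(m, n)) (sigma : R) : Prop := {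
  sg_measurable :
    measurable_fun [set: 'M[R]_(m, n) * X] (fun z => G z.1 z.2);
  sg_unbiased : forall W i j,
    ('E_D[fun x => G W x i j] = (grad f W i j)%:E)%E;
  sg_variance : forall W,
    ('E_D[fun x => (frobenius_norm (G W x - grad f W) ^+ 2)%R]
       <= (sigma ^+ 2)%:E)%E
}.

Definition batch_grad m n (X : Type) (G : 'M[R]_(m, n) -> X -> 'M[R]_(m, n))
    b (W : 'M[R]_(m, n)) (B : 'I_b -> X) : 'M[R]_(m, n) :=
  b%:R^-1 *: \sum_(i < b) G W (B i).

(* The random sequences of a run over the sample space T. Index t is step t of
   the algorithm, so index 0 is only meaningful for the RSVD factors. *)
Record mlorc_vars (T X : Type) (m n r p b : nat) := {
  sample : nat -> 'I_b -> T -> X;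
  test_mx : nat -> T -> 'M[R]_(n, r + p);
  iter_W : nat -> T -> 'M[R]_(m, n);
  grad_g : nat -> T -> 'M[R]_(m, n);
  dir_c : nat -> T -> 'M[R]_(m, n);
  mom_m : nat -> T -> 'M[R]_(m, n);
  mom_u : nat -> T -> 'M[R]_(m, r);
  mom_s : nat -> T -> 'M[R]_r;
  mom_v : nat -> T -> 'M[R]_(n, r)
}.

Definition mom_low T X m n r p b (Z : mlorc_vars T X m n r p b)
    (t : nat) (w : T) : 'M[R]_(m, n) :=
  mom_u Z t w *m mom_s Z t w *m (mom_v Z t w)^T.

Section run.
Context {dT} {T : measurableType dT} (P : probability T R).
Context {dX} {X : measurableType dX} (D : probability X R).
Context {m n r p b : nat}.
Implicit Types Z : mlorc_vars T X m n r p b.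

Definition batch_events Z t : set (set T) :=
  <<s \bigcup_(i in [set: 'I_b]) sigma_of (sample Z t i) >>.

(* Everything drawn strictly before step t; the factors are listed because
   they may involve a choice among the admissible RSVD outputs. *)
Definition past_events Z t : set (set T) :=
  <<s \bigcup_(s in [set s | (0 < s < t)%N])
        (batch_events Z s `|` sigma_of (test_mx Z s) `|`
         sigma_of (mom_u Z s) `|` sigma_of (mom_s Z s) `|`
         sigma_of (mom_v Z s)) >>.

Definition past_and_batch_events Z t : set (set T) :=
  <<s past_events Z t `|` batch_events Z t >>.

Record is_mlorc_lion (G : 'M[R]_(m, n) -> X -> 'M[R]_(m, n))
    (W1 : 'M[R]_(m, n)) (alpha beta1 beta2 : R) Z : Prop := {
  ml_init_W : forall w, iter_W Z 1 w = W1;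
  ml_init_u : forall w, mom_u Z 0 w = 0;
  ml_init_s : forall w, mom_s Z 0 w = 0;
  ml_init_v : forall w, mom_v Z 0 w = 0;
  ml_sample : forall t, (0 < t)%N -> iid_with_law P D (sample Z t);
  ml_sample_fresh : forall t, (0 < t)%N ->
    independent_systems P (past_events Z t) (batch_events Z t);
  ml_grad : forall t, (0 < t)%N -> forall w,
    grad_g Z t w = batch_grad G (iter_W Z t w) (fun i => sample Z t i w);
  ml_dir : forall t, (0 < t)%N -> forall w,
    dir_c Z t w = beta1 *: mom_low Z t.-1 w + (1 - beta1) *: grad_g Z t w;
  ml_mom : forall t, (0 < t)%N -> forall w,
    mom_m Z t w = beta2 *: mom_low Z t.-1 w + (1 - beta2) *: grad_g Z t w;
  ml_gauss : forall t, (0 < t)%N ->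
    iid_with_law P (normal_prob 0 1)
      (fun (ij : 'I_n * 'I_(r + p)) w => test_mx Z t w ij.1 ij.2);
  ml_gauss_fresh : forall t, (0 < t)%N ->
    independent_systems P (past_and_batch_events Z t) (sigma_of (test_mx Z t));
  ml_factors_measurable : forall t, (0 < t)%N ->
    [/\ measurable_fun setT (mom_u Z t), measurable_fun setT (mom_s Z t)
      & measurable_fun setT (mom_v Z t)];
  ml_rsvd : forall t, (0 < t)%N -> forall w,
    is_RSVD (mom_m Z t w) (test_mx Z t w)
      (mom_u Z t w) (mom_s Z t w) (mom_v Z t w);
  ml_step : forall t, (0 < t)%N -> forall w,
    iter_W Z t.+1 w = iter_W Z t w - alpha *: sign_mx (dir_c Z t w)
}.

End run.

Definition avg_grad_norm dT (T : measurableType dT) (P : probability T R)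
    m n (f : 'M[R]_(m, n) -> R) (W : nat -> T -> 'M[R]_(m, n)) (N : nat) :
    \bar R :=
  ((N%:R^-1)%:E *
   \sum_(1 <= t < N.+1) 'E_P[fun w => norm11 (grad f (W t w))])%E.

End optimization.

(* Main.v *)
(* Normalizing the direction, sign(c_t) = sign(grad f(W_t) + e_t + mu m~_(t-1)) with
   e_t = g_t - grad f(W_t) and mu = beta1 / (1 - beta1).  The descent inequality loses
   only where this sign differs from the sign of the gradient; the loss is at most
   |e|_(1,1) - <sign(grad f), e> + 2 mu |m~|_(1,1), and since e_t has conditional mean
   zero the noise enters with constant 1, not 2.  This matters because the term
   E[f(W_1) - f(W_(T+1))] of the bound may be negative.

   The Gaussian analysis of the randomized SVD is not needed: for every test matrix the
   output has Frobenius norm at most that of its input, so the momentum recursion gives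
   sum_t |m~_(t-1)|_F <= sum_t |g_t|_F pathwise, and the bound on beta1 absorbs the
   resulting gradient norms, leaving a third of sum_t |grad f(W_t)|_(1,1).

   The iterates take finitely many values, so the conditional expectation of the noise
   given W_t is a finite sum over events independent of the batch. *)
From HB Require Import structures.
Require Import Defs.
From mathcomp Require Import all_boot all_order all_algebra.
From mathcomp Require Import all_classical all_reals all_analysis.
From mathcomp Require Import measurable_realfun ring lra.
Set Implicit Arguments.
Unset Strict Implicit.
Unset Printing Implicit Defensive.
Import Order.TTheory GRing.Theory Num.Theory.
Import numFieldNormedType.Exports.
Local Open Scope classical_set_scope.
Local Open Scope ring_scope.

(** * Frobenius norm, signs and truncated SVD *)

Section frobenius.
Context {R : realType}.

(** The Frobenius inner product, kept as an entrywise sum because the sign arguments below work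
    entry by entry. *)
Definition mxdot m n (A B : 'M[R]_(m, n)) : R := \sum_(i < m) \sum_(j < n) A i j * B i j.

Lemma frobenius_ge0 m n (A : 'M[R]_(m, n)) : 0 <= frobenius_norm A.
Proof. exact: sqrtr_ge0. Qed.

Lemma frobenius_sqr m n (A : 'M[R]_(m, n)) :
  frobenius_norm A ^+ 2 = \sum_(i < m) \sum_(j < n) A i j ^+ 2.
Proof.
by rewrite sqr_sqrtr//; apply: sumr_ge0 => i _; apply: sumr_ge0 => j _; exact: sqr_ge0.
Qed.

Lemma frobenius_le m n m' n' (A : 'M[R]_(m, n)) (B : 'M[R]_(m', n')) :
  frobenius_norm A ^+ 2 <= frobenius_norm B ^+ 2 -> frobenius_norm A <= frobenius_norm B.
Proof. by rewrite ler_pXn2r// nnegrE frobenius_ge0. Qed.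

Lemma frobenius_sqr_trace m n (A : 'M[R]_(m, n)) :
  frobenius_norm A ^+ 2 = \tr (A^T *m A).
Proof.
rewrite frobenius_sqr exchange_big/=; apply: eq_bigr => j _; rewrite !mxE.
by apply: eq_bigr => i _; rewrite !mxE expr2.
Qed.

Lemma mxdotxx m n (A : 'M[R]_(m, n)) : mxdot A A = frobenius_norm A ^+ 2.
Proof. by rewrite frobenius_sqr; apply: eq_bigr => i _; apply: eq_bigr => j _; rewrite expr2. Qed.

Lemma mxdotC m n (A B : 'M[R]_(m, n)) : mxdot A B = mxdot B A.
Proof. by apply: eq_bigr => i _; apply: eq_bigr => j _; rewrite mulrC. Qed.

Lemma mxdotDr m n (A B C : 'M[R]_(m, n)) : mxdot A (B + C) = mxdot A B + mxdot A C.
Proof.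
rewrite /mxdot -big_split/=; apply: eq_bigr => i _; rewrite -big_split/=.
by apply: eq_bigr => j _; rewrite mxE mulrDr.
Qed.

Lemma mxdotZr m n (A B : 'M[R]_(m, n)) k : mxdot A (k *: B) = k * mxdot A B.
Proof.
rewrite /mxdot mulr_sumr; apply: eq_bigr => i _; rewrite mulr_sumr.
by apply: eq_bigr => j _; rewrite mxE mulrCA.
Qed.

Lemma mxdotDl m n (A B C : 'M[R]_(m, n)) : mxdot (A + B) C = mxdot A C + mxdot B C.
Proof. by rewrite ![mxdot _ C]mxdotC mxdotDr. Qed.

Lemma mxdotZl m n (A B : 'M[R]_(m, n)) k : mxdot (k *: A) B = k * mxdot A B.
Proof. by rewrite ![mxdot _ B]mxdotC mxdotZr. Qed.

Lemma frobenius_eq0 m n (A : 'M[R]_(m, n)) : frobenius_norm A = 0 -> A = 0.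
Proof.
move=> A0; have : frobenius_norm A ^+ 2 = 0 by rewrite A0 expr0n.
rewrite frobenius_sqr => /eqP; rewrite psumr_eq0; last first.
  by move=> i _; apply: sumr_ge0 => j _; exact: sqr_ge0.
move=> /allP H; apply/matrixP => i j; rewrite mxE.
have := H i (mem_index_enum _) => /=; rewrite psumr_eq0; last by move=> *; exact: sqr_ge0.
by move=> /allP/(_ j (mem_index_enum _))/=; rewrite sqrf_eq0 => /eqP.
Qed.

Lemma mxdot0l m n (A : 'M[R]_(m, n)) : mxdot 0 A = 0.
Proof. by rewrite /mxdot big1// => i _; rewrite big1// => j _; rewrite mxE mul0r. Qed.

(** Cauchy-Schwarz: expand the square of [b *: A - a *: B], with [a] and [b] the two norms, and
    divide by [a * b]; a zero norm forces a zero matrix. *)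
Lemma mxdot_le_frobenius m n (A B : 'M[R]_(m, n)) :
  mxdot A B <= frobenius_norm A * frobenius_norm B.
Proof.
set a := frobenius_norm A; set b := frobenius_norm B.
have : 0 <= frobenius_norm (b *: A - a *: B) ^+ 2 by exact: sqr_ge0.
rewrite -mxdotxx -scaleNr !(mxdotDl, mxdotDr, mxdotZl, mxdotZr) !mxdotxx (mxdotC B A).
rewrite -/a -/b => h.
have a0 : 0 <= a := frobenius_ge0 A.
have b0 : 0 <= b := frobenius_ge0 B.
have {}h : a * b * mxdot A B <= (a * b) * (a * b) by nra.
have [/frobenius_eq0 ->|an0] := eqVneq a 0; first by rewrite mxdot0l mulr_ge0.
have [/frobenius_eq0 ->|bn0] := eqVneq b 0; first by rewrite mxdotC mxdot0l mulr_ge0.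
by move: h; rewrite ler_pM2l// mulr_gt0// lt_neqAle eq_sym ?an0 ?bn0.
Qed.

Lemma frobeniusD m n (A B : 'M[R]_(m, n)) :
  frobenius_norm (A + B) <= frobenius_norm A + frobenius_norm B.
Proof.
have := mxdot_le_frobenius A B.
have := frobenius_ge0 A; have := frobenius_ge0 B; have := frobenius_ge0 (A + B).
have : frobenius_norm (A + B) ^+ 2 =
  frobenius_norm A ^+ 2 + 2 * mxdot A B + frobenius_norm B ^+ 2.
  by rewrite -!mxdotxx !(mxdotDl, mxdotDr) (mxdotC B A); ring.
by move: (frobenius_norm (A + B)) (frobenius_norm A) (frobenius_norm B) => x y z; nra.
Qed.

Lemma frobeniusZ m n (A : 'M[R]_(m, n)) k :
  frobenius_norm (k *: A) = `|k| * frobenius_norm A.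
Proof.
apply/eqP; rewrite -(@eqrXn2 _ 2)// ?mulr_ge0 ?frobenius_ge0//.
by rewrite exprMn -!mxdotxx mxdotZl mxdotZr real_normK ?num_real// mulrA expr2.
Qed.

Lemma frobenius0 m n : frobenius_norm (0 : 'M[R]_(m, n)) = 0.
Proof. by rewrite -(scale0r (0 : 'M[R]_(m,n))) frobeniusZ normr0 mul0r. Qed.

Lemma norm11_ge0 m n (A : 'M[R]_(m, n)) : 0 <= norm11 A.
Proof. by apply: sumr_ge0 => i _; apply: sumr_ge0. Qed.

(** Cauchy-Schwarz for the all-ones matrix against the matrix of absolute values. *)
Lemma norm11_le_frobenius m n (A : 'M[R]_(m, n)) :
  norm11 A <= Num.sqrt (m * n)%:R * frobenius_norm A.
Proof.
have -> : norm11 A = mxdot (const_mx 1) (map_mx Num.norm A).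
  by apply: eq_bigr => i _; apply: eq_bigr => j _; rewrite !mxE mul1r.
have -> : frobenius_norm A = frobenius_norm (map_mx Num.norm A).
  by congr Num.sqrt; apply: eq_bigr => i _; apply: eq_bigr => j _;
    rewrite !mxE real_normK ?num_real.
apply: le_trans (mxdot_le_frobenius _ _) _.
rewrite ler_wpM2r ?frobenius_ge0//; apply: ler_wsqrtr.
under eq_bigr do under eq_bigr do rewrite mxE expr1n.
by rewrite !(sumr_const, card_ord) -mulrnA mulnC.
Qed.

(** Each entry is at most [norm11 A] in absolute value; replacing one factor of every square by it
    gives [norm11 A ^+ 2]. *)
Lemma frobenius_le_norm11 m n (A : 'M[R]_(m, n)) : frobenius_norm A <= norm11 A.
Proof.
rewrite -(@ler_pXn2r _ 2) ?nnegrE ?frobenius_ge0 ?norm11_ge0//.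
rewrite frobenius_sqr expr2 {1}/norm11 mulr_suml; apply: ler_sum => i _.
rewrite mulr_suml; apply: ler_sum => j _.
rewrite -real_normK ?num_real// expr2 ler_wpM2l//.
rewrite /norm11 (bigD1 i)//= (bigD1 j)//= -addrA lerDl addr_ge0//.
  by apply: sumr_ge0.
by apply: sumr_ge0 => k _; apply: sumr_ge0.
Qed.

Lemma frobenius_sign_sqr m n (A : 'M[R]_(m, n)) :
  frobenius_norm (sign_mx A) ^+ 2 <= (m * n)%:R.
Proof.
rewrite frobenius_sqr.
have -> : (m * n)%:R = \sum_(i < m) \sum_(j < n) 1 :> R.
  by rewrite !(sumr_const, card_ord) -mulrnA mulnC.
apply: ler_sum => i _; apply: ler_sum => j _; rewrite mxE sqr_sg.
by case: (_ != _); rewrite ?ler01.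
Qed.

(* When the sign of x + u is wrong, |x| <= |u| and u points against x. *)
Lemma sign_error_le (x u : R) : `|x| - x * Num.sg (x + u) <= `|u| - Num.sg x * u.
Proof.
have [->|xn0] := eqVneq x 0; first by rewrite normr0 sgr0 !mul0r subrr subr0.
have [x0|x0] : x < 0 \/ 0 < x by apply/orP; rewrite -neq_lt.
- rewrite (ltr0_norm x0) (ltr0_sg x0) mulN1r opprK.
  have : 0 <= `|u| + u by rewrite -lerBlDr sub0r -normrN ler_norm.
  have := ler_norm u.
  by case: sgrP => h; rewrite ?(mulr0, mulr1, mulrN1); lra.
- rewrite (gtr0_norm x0) (gtr0_sg x0) mul1r.
  have : 0 <= `|u| - u by rewrite subr_ge0 ler_norm.
  have := ler_norm (- u); rewrite normrN.
  by case: sgrP => h; rewrite ?(mulr0, mulr1, mulrN1); lra.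
Qed.

(** [sign_error_le] is applied entrywise, with [u] the entry of [E + mu *: M]. The part from [E]
    keeps its signed term, which will have mean zero; the part from [M] is bounded twice in absolute
    value, whence the 2. A positive [k] does not change signs. *)
Lemma mxdot_sign_ge m n (A E M : 'M[R]_(m, n)) (k mu : R) : 0 < k -> 0 <= mu ->
  norm11 A - (norm11 E - mxdot (sign_mx A) E) - 2 * mu * norm11 M <=
  mxdot A (sign_mx (k *: (A + E + mu *: M))).
Proof.
move=> k0 mu0; rewrite lerBlDr lerBlDr.
rewrite /norm11 /mxdot mulr_sumr -sumrB -!big_split/=; apply: ler_sum => i _.
rewrite mulr_sumr -sumrB -!big_split/=; apply: ler_sum => j _.
rewrite !mxE sgrM (gtr0_sg k0) mul1r.
have := sign_error_le (A i j) (E i j + mu * M i j).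
have := ler_normD (E i j) (mu * M i j); rewrite normrM (ger0_norm mu0) !addrA.
have := ler_norm (- (Num.sg (A i j) * (mu * M i j))); rewrite normrN normrM.
have : `|Num.sg (A i j)| * `|mu * M i j| <= mu * `|M i j|.
  rewrite normrM (ger0_norm mu0) ler_piMl ?mulr_ge0// normr_sg.
  by case: (_ != _); rewrite ?ler01.
by rewrite mulrDr; lra.
Qed.

Lemma frobenius_orthonormal m l n (Q : 'M[R]_(m, l)) (A : 'M[R]_(l, n)) :
  orthonormal_columns Q -> frobenius_norm (Q *m A) = frobenius_norm A.
Proof.
move=> QQ; apply/eqP; rewrite -(@eqrXn2 _ 2)// ?frobenius_ge0//.
by rewrite !frobenius_sqr_trace trmx_mul mulmxA -(mulmxA _ Q^T) QQ mulmx1.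
Qed.

(** Pairing [Q *m (Q^T *m A)] with [A] gives the square of the norm of [Q^T *m A]; Cauchy-Schwarz
    and the isometry [Q] bound it by that norm times the norm of [A]. *)
Lemma frobenius_orthonormal_tr m l n (Q : 'M[R]_(m, l)) (A : 'M[R]_(m, n)) :
  orthonormal_columns Q -> frobenius_norm (Q^T *m A) <= frobenius_norm A.
Proof.
move=> QQ.
have e : mxdot (Q *m (Q^T *m A)) A = frobenius_norm (Q^T *m A) ^+ 2.
  rewrite frobenius_sqr_trace trmx_mul trmxK /mxdot /mxtrace exchange_big/=.
  apply: eq_bigr => j _; rewrite -mulmxA mxE; apply: eq_bigr => i _.
  by rewrite !mxE mulrC.
have := mxdot_le_frobenius (Q *m (Q^T *m A)) A; rewrite e (frobenius_orthonormal _ QQ).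
have [e0|x0] := eqVneq (frobenius_norm (Q^T *m A)) 0; first by rewrite e0 frobenius_ge0.
by rewrite expr2 ler_pM2l// lt_neqAle eq_sym x0 frobenius_ge0.
Qed.

Lemma orthonormal_lsubmx m r p (Q : 'M[R]_(m, r + p)) :
  orthonormal_columns Q -> orthonormal_columns (lsubmx Q).
Proof.
move=> /matrixP QQ; apply/matrixP => i j.
have := QQ (lshift p i) (lshift p j); rewrite !mxE (inj_eq (@lshift_inj _ _)) => <-.
by apply: eq_bigr => k _; rewrite !mxE.
Qed.

Lemma frobenius_trmx m n (A : 'M[R]_(m, n)) : frobenius_norm A^T = frobenius_norm A.
Proof.
congr Num.sqrt; rewrite exchange_big/=; apply: eq_bigr => i _.
by apply: eq_bigr => j _; rewrite mxE.
Qed.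

Lemma frobenius_SVD l k n (U : 'M[R]_(l, k)) (s : 'rV[R]_k) (V : 'M[R]_(n, k)) :
  orthonormal_columns U -> orthonormal_columns V ->
  frobenius_norm (U *m diag_mx s *m V^T) ^+ 2 = \sum_i s 0 i ^+ 2.
Proof.
move=> UU VV; rewrite -mulmxA frobenius_orthonormal// -frobenius_trmx trmx_mul trmxK.
rewrite frobenius_orthonormal// frobenius_trmx frobenius_sqr; apply: eq_bigr => i _.
rewrite (bigD1 i)//= big1 ?addr0 ?mxE ?eqxx// => j ji.
by rewrite mxE eq_sym (negbTE ji) mulr0n expr0n.
Qed.

(** [Q] and the truncated singular vectors act isometrically, truncation only drops squares of
    singular values, and [Q^T] contracts. The argument is the same for every test matrix and every
    choice of the two decompositions. *)
Lemma frobenius_RSVD m n r p (A : 'M[R]_(m, n)) (Om : 'M[R]_(n, r + p))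
    (U : 'M[R]_(m, r)) (S : 'M[R]_r) (V : 'M[R]_(n, r)) :
  is_RSVD A Om U S V -> frobenius_norm (U *m S *m V^T) <= frobenius_norm A.
Proof.
move=> [Q [T [UB [s [VB [[QQ _ _] [UU VV _ _ B] -> -> ->]]]]]].
apply: le_trans (frobenius_orthonormal_tr A QQ).
rewrite -!mulmxA frobenius_orthonormal//; apply: frobenius_le.
rewrite B mulmxA !frobenius_SVD//; try exact: orthonormal_lsubmx.
rewrite big_split_ord/= -[leLHS]addr0 lerD ?sumr_ge0//.
  by apply: ler_sum => i _; rewrite mxE.
by move=> i _; exact: sqr_ge0.
Qed.
End frobenius.

(** * Pathwise descent *)

Section descent.
Context {R : realType}.

(** Differentiability makes the directional derivative linear in [D], so it can be expanded over the
    [delta_mx]. *)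
Lemma derive_grad m n (f : 'M[R]_(m, n) -> R) (W D : 'M[R]_(m, n)) :
  differentiable f W -> 'D_D f W = mxdot (grad f W) D.
Proof.
move=> df; rewrite deriveE// {1}(matrix_sum_delta D) linear_sum; apply: eq_bigr => i _.
rewrite linear_sum; apply: eq_bigr => j _.
by rewrite linearZ mxE deriveE//= mulrC.
Qed.

Lemma is_derive_line m n (f : 'M[R]_(m, n) -> R) (W D : 'M[R]_(m, n)) (x : R) :
  differentiable f (W + x *: D) ->
  is_derive x 1 (fun y : R => f (W + y *: D)) (mxdot (grad f (W + x *: D)) D).
Proof.
move=> df.
(* Derivability and derivative along the line both reduce to the difference quotient of [f] at
   [W + x *: D] in direction [D]. *)
have e : (fun h : R => h^-1 *: (f (W + (h *: 1 + x) *: D) - f (W + x *: D))) =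
         (fun h : R => h^-1 *: (f (h *: D + (W + x *: D)) - f (W + x *: D))).
  by apply: funext => h; rewrite scaler1 scalerDl addrCA.
split.
- by rewrite /derivable /= e; exact: diff_derivable.
- by rewrite /derive /= e -derive_grad.
Qed.

Lemma descent_inequality m n (f : 'M[R]_(m, n) -> R) (L : R) (W D : 'M[R]_(m, n)) :
  smooth_bounded_below f L ->
  f (W + D) <= f W + mxdot (grad f W) D + L / 2 * frobenius_norm D ^+ 2.
Proof.
move=> [df _ Lf].
pose N := frobenius_norm D ^+ 2; pose k := mxdot (grad f W) D.
(* Subtracting the first-order term and the target quadratic leaves a function with nonpositive
   derivative between 0 and 1, by Cauchy-Schwarz and the Lipschitz gradient. The mean value theorem
   then gives [phi 1 <= phi 0]. *)
pose phi (x : R) := f (W + x *: D) - x * k - L / 2 * N * x ^+ 2.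
have dphi (x : R) : is_derive x 1 phi (mxdot (grad f (W + x *: D)) D - k - L * N * x).
  have h := is_derive_line (df (W + x *: D)).
  move: (mxdot (grad f (W + x *: D)) D) h => a h.
  rewrite /phi; apply: is_derive_eq.
  by rewrite !scaler1 /GRing.scale /=; field.
have cphi : {within `[0, 1], continuous phi}.
  apply: continuous_subspaceT => y; apply: differentiable_continuous.
  by apply/derivable1_diffP; case: (dphi y).
have [c] := MVT (ltr01 : (0 < 1 :> R)) (fun y _ => dphi y) cphi.
rewrite in_itv/= => /andP[c0 c1]; rewrite subr0 mulr1.
have : mxdot (grad f (W + c *: D)) D - k <= L * N * c.
  rewrite /k -mulN1r -mxdotZl -mxdotDl scaleN1r.
  apply: le_trans (mxdot_le_frobenius _ _) _.
  apply: (@le_trans _ _ (L * (c * frobenius_norm D) * frobenius_norm D)); last by rewrite /N; lra.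
  rewrite ler_wpM2r ?frobenius_ge0//; apply: le_trans (Lf _ _) _.
  by rewrite addrC addKr frobeniusZ (gtr0_norm c0).
rewrite /phi scale1r scale0r addr0 -/N -/k; lra.
Qed.

(** [descent_inequality] for the step [- (alpha *: S)], with [mxdot_sign_ge] for the inner product.
    In use, [k] is [1 - beta1], [mu] is [beta1 / (1 - beta1)], [E] is the gradient noise and [M] the
    previous momentum. *)
Lemma sign_step_descent m n (f : 'M[R]_(m, n) -> R) (L alpha mu k : R)
    (W E M : 'M[R]_(m, n)) :
  smooth_bounded_below f L -> 0 <= L -> 0 < alpha -> 0 < k -> 0 <= mu ->
  norm11 (grad f W) <=
    (f W - f (W - alpha *: sign_mx (k *: (grad f W + E + mu *: M)))) / alpha
    + (norm11 E - mxdot (sign_mx (grad f W)) E) + 2 * mu * norm11 M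
    + L * alpha / 2 * (m * n)%:R.
Proof.
move=> sf L0 a0 k0 mu0; set S := sign_mx _.
have := descent_inequality W (- (alpha *: S)) sf.
rewrite -scaleNr mxdotZr frobeniusZ normrN (gtr0_norm a0) exprMn.
set T := frobenius_norm S ^+ 2 => h1.
have h2 := mxdot_sign_ge (grad f W) E M k0 mu0; rewrite -/S in h2.
have h3 : L * T <= L * (m * n)%:R by rewrite ler_wpM2l// frobenius_sign_sqr.
have {}h3 := ler_wpM2l (ltW a0) h3.
rewrite -!addrA -lerBlDr ler_pdivlMr//.
have {}h2 := ler_wpM2l (ltW a0) h2.
have {}h3 := ler_wpM2l (ltW a0) h3.
lra.
Qed.
End descent.

(** * Summation along a run *)

Section pathwise.
Context {R : realType}.

Lemma momentum_sum_le (beta : R) (M g : nat -> R) (N : nat) :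
  beta < 1 -> M 0%N = 0 -> (forall t, 0 <= M t) ->
  (forall t, M t.+1 <= beta * M t + (1 - beta) * g t.+1) ->
  \sum_(1 <= t < N.+1) M t.-1 <= \sum_(1 <= t < N.+1) g t.
Proof.
move=> b1 M0 Mge0 step; rewrite !big_add1/=.
rewrite -(@ler_pM2l _ (1 - beta)) ?subr_gt0//.
have : (1 - beta) * \sum_(0 <= i < N) M i + M N <= (1 - beta) * \sum_(0 <= i < N) g i.+1.
  elim: N => [|N IH]; first by rewrite !big_geq// M0 addr0.
  by rewrite !big_nat_recr//= !mulrDr; have := step N; lra.
by apply: le_trans; rewrite lerDl.
Qed.

(** All that the noise of one step can cost. The first two terms are the loss from wrong signs; the
    last pays for the noise that reaches later directions through the momentum. *)
Definition direction_noise m n (A E : 'M[R]_(m, n)) : R :=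
  norm11 E - mxdot (sign_mx A) E + 2 / 3 * frobenius_norm E.

Lemma mxdot_sign_le m n (A E : 'M[R]_(m, n)) : mxdot (sign_mx A) E <= norm11 E.
Proof.
apply: ler_sum => i _; apply: ler_sum => j _; rewrite mxE.
apply: le_trans (ler_norm _) _; rewrite normrM normr_sg.
by case: (_ != _); rewrite ?mul1r ?mul0r.
Qed.

(** Nonnegativity lets an upper bound serve as a bound on the absolute value, and so give
    integrability. *)
Lemma direction_noise_ge0 m n (A E : 'M[R]_(m, n)) : 0 <= direction_noise A E.
Proof.
have := mxdot_sign_le A E; have := frobenius_ge0 E.
by rewrite /direction_noise; lra.
Qed.

(** The summed descent inequalities telescope. The momentum costs at most 2/3 of the sum of the
    norms of the [g t], hence 2/3 of the gradient sum plus noise; moving that gradient part to the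
    left leaves a third, whence the factor 3. *)
Lemma lion_pathwise m n (f : 'M[R]_(m, n) -> R) (L alpha beta1 beta2 : R)
    (W g M : nat -> 'M[R]_(m, n)) (N : nat) :
  smooth_bounded_below f L -> 0 <= L -> 0 < alpha -> 0 <= beta1 < 1 -> 0 <= beta2 < 1 ->
  3 * beta1 * Num.sqrt (m * n)%:R <= 1 - beta1 ->
  M 0%N = 0 ->
  (forall t, frobenius_norm (M t.+1) <=
     frobenius_norm (beta2 *: M t + (1 - beta2) *: g t.+1)) ->
  (forall t, W t.+2 =
     W t.+1 - alpha *: sign_mx (beta1 *: M t + (1 - beta1) *: g t.+1)) ->
  \sum_(1 <= t < N.+1) norm11 (grad f (W t)) <=
    3 * ((f (W 1%N) - f (W N.+1)) / alpha
         + N%:R * (L * alpha / 2 * (m * n)%:R)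
         + \sum_(1 <= t < N.+1)
             direction_noise (grad f (W t)) (g t - grad f (W t))).
Proof.
move=> sf L0 a0 /andP[b10 b11] /andP[b20 b21] b1d M0 hM hW.
set s := Num.sqrt _ in b1d.
pose e t := g t - grad f (W t).
have b1' : 0 < 1 - beta1 by rewrite subr_gt0.
pose mu := beta1 / (1 - beta1).
have mu0 : 0 <= mu by rewrite divr_ge0// ltW.
(* Passing from [norm11] of the momentum to its Frobenius norm costs [s], and this product is the
   resulting coefficient. *)
have mus : mu * s <= 3^-1.
  by rewrite /mu mulrAC ler_pdivrMr//; lra.
have s0 : 0 <= s by exact: sqrtr_ge0.
have hMg : \sum_(1 <= t < N.+1) frobenius_norm (M t.-1) <=
           \sum_(1 <= t < N.+1) frobenius_norm (g t).
  apply: (@momentum_sum_le beta2 (fun t => frobenius_norm (M t))) => //.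
  - by rewrite M0 frobenius0.
  - by move=> t; exact: frobenius_ge0.
  - move=> t; apply: le_trans (hM t) _; apply: le_trans (frobeniusD _ _) _.
    by rewrite !frobeniusZ !ger0_norm// subr_ge0 ltW.
have hge : \sum_(1 <= t < N.+1) frobenius_norm (g t) <=
    \sum_(1 <= t < N.+1) norm11 (grad f (W t)) + \sum_(1 <= t < N.+1) frobenius_norm (e t).
  rewrite -big_split/=; apply: ler_sum => t _.
  rewrite -{1}(subrK (grad f (W t)) (g t)) -/(e t); apply: le_trans (frobeniusD _ _) _.
  rewrite addrC lerD2l; exact: frobenius_le_norm11.
have hsum : \sum_(1 <= t < N.+1) norm11 (grad f (W t)) <=
    (f (W 1%N) - f (W N.+1)) / alpha +
    \sum_(1 <= t < N.+1) (norm11 (e t) - mxdot (sign_mx (grad f (W t))) (e t)) +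
    2 / 3 * (\sum_(1 <= t < N.+1) frobenius_norm (M t.-1)) +
    N%:R * (L * alpha / 2 * (m * n)%:R).
  rewrite !big_add1/=; elim: N {hMg hge} => [|N IH].
    by rewrite !big_geq// subrr !(mul0r, mulr0, addr0).
  rewrite !big_nat_recr//= mulrDr -(natr1 N) [(N%:R + 1) * _]mulrDl mul1r.
  have := sign_step_descent (W N.+1) (e N.+1) (M N) sf L0 a0 b1' mu0.
  have -> : (1 - beta1) *: (grad f (W N.+1) + e N.+1 + mu *: M N) =
      beta1 *: M N + (1 - beta1) *: g N.+1.
    rewrite /e [grad _ _ + _]addrC subrK scalerDr scalerA addrC /mu.
    by rewrite [_ * (_ / _)]mulrC divfK ?gt_eqF.
  rewrite -hW.
  have : 2 * mu * norm11 (M N) <= 2 / 3 * frobenius_norm (M N).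
    have h := norm11_le_frobenius (M N); have h0 := frobenius_ge0 (M N).
    have h1 := ler_wpM2l mu0 h; rewrite -/s mulrA in h1.
    have h2 := ler_wpM2r h0 mus; lra.
  by rewrite !mulrBl in IH *; lra.
have -> : \sum_(1 <= t < N.+1) direction_noise (grad f (W t)) (g t - grad f (W t)) =
    \sum_(1 <= t < N.+1) (norm11 (e t) - mxdot (sign_mx (grad f (W t))) (e t)) +
    2 / 3 * \sum_(1 <= t < N.+1) frobenius_norm (e t).
  by rewrite mulr_sumr -big_split.
lra.
Qed.
End pathwise.

(** * Means and independence *)

Section mean.
Context {R : realType}.
Local Open Scope ereal_scope.

(** Integrability and a real value travel together, so that linear combinations and comparisons of
    means carry no further side conditions. *)
Definition has_mean d (T : measurableType d) (P : {measure set T -> \bar R})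
    (h : T -> R) (e : R) : Prop :=
  P.-integrable setT (EFin \o h) /\ \int[P]_w (h w)%:E = e%:E.

Section mean_lemmas.
Context d (T : measurableType d) (P : probability T R).
Implicit Types h k : T -> R.

Lemma has_mean_measurable h e : has_mean P h e -> measurable_fun setT h.
Proof. by move=> [/measurable_int/measurable_EFinP]. Qed.

Lemma has_mean_ext h k e : h =1 k -> has_mean P h e -> has_mean P k e.
Proof. by move=> /funext ->. Qed.

Lemma has_mean_expectation h e : has_mean P h e -> 'E_P[h] = e%:E.
Proof. by move=> [_]; rewrite unlock. Qed.

Lemma has_mean_cst c : has_mean P (cst c) c.
Proof.
split; first exact: finite_measure_integrable_cst.
by have := expectation_cst P c; rewrite unlock.
Qed.

Lemma has_meanD h k a b : has_mean P h a -> has_mean P k b ->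
  has_mean P (fun w => h w + k w)%R (a + b)%R.
Proof.
move=> [ih eh] [ik ek]; split; first exact: (integrableD _ ih ik).
by rewrite EFinD -eh -ek -integralD_EFin.
Qed.

Lemma has_meanZ h a c : has_mean P h a -> has_mean P (fun w => c * h w)%R (c * a)%R.
Proof.
move=> [ih eh]; split; first exact: (integrableZl _ c ih).
by rewrite EFinM -eh -integralZl.
Qed.

Lemma has_meanB h k a b : has_mean P h a -> has_mean P k b ->
  has_mean P (fun w => h w - k w)%R (a - b)%R.
Proof.
move=> hh /(has_meanZ (-1)%R) hk; rewrite -mulN1r.
by apply: has_mean_ext (has_meanD hh hk) => w; rewrite mulN1r.
Qed.

Lemma has_mean_sum (I : Type) (s : seq I) (F : I -> T -> R) (a : I -> R) :
  (forall i, has_mean P (F i) (a i)) ->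
  has_mean P (fun w => \sum_(i <- s) F i w)%R (\sum_(i <- s) a i)%R.
Proof.
move=> H; elim: s => [|i s IH].
  by rewrite big_nil; apply: has_mean_ext (has_mean_cst 0) => w; rewrite big_nil.
rewrite big_cons; apply: has_mean_ext (has_meanD (H i) IH) => w.
by rewrite big_cons.
Qed.

Lemma has_mean_le h k a b : has_mean P h a -> has_mean P k b ->
  (forall w, h w <= k w)%R -> (a <= b)%R.
Proof.
move=> [ih eh] [ik ek] hk; rewrite -lee_fin -eh -ek; apply: le_integral => //.
by move=> w _; rewrite lee_fin.
Qed.

Lemma has_mean_dominated h k b : measurable_fun setT h ->
  (forall w, `|h w| <= k w)%R -> has_mean P k b -> exists a, has_mean P h a.
Proof.
move=> mh hk [ik ek].
have ih : P.-integrable setT (EFin \o h).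
  apply: le_integrable ik => //; first exact/measurable_EFinP.
  by move=> w _ /=; rewrite lee_fin (le_trans (hk w))// ler_norm.
exists (fine (\int[P]_w (h w)%:E)); split => //.
by rewrite fineK//; exact: integrable_fin_num.
Qed.

End mean_lemmas.

(** Agreement of the law of [X] with [D] on measurable sets turns integrals against [D] into
    integrals against the pushforward, where change of variables applies. *)
Lemma has_mean_distribution d (T : measurableType d) d' (S : measurableType d')
    (P : probability T R) (D : probability S R) (X : T -> S) (phi : S -> R) e :
  measurable_fun setT X -> (forall A, measurable A -> P (X @^-1` A) = D A) ->
  has_mean D phi e -> has_mean P (phi \o X) e.
Proof.
move=> mX XD hphi; have mphi := has_mean_measurable hphi.
have [iphi ephi] := hphi.
have mephi : measurable_fun setT (EFin \o phi) by exact/measurable_EFinP.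
have eD g : \int[D]_y g y = \int[pushforward P X]_y g y.
  by apply: eq_measure_integral => A mA _; exact/esym/XD.
have i2 : P.-integrable setT (EFin \o (phi \o X)).
  apply/integrableP; split.
    by apply/measurable_EFinP; exact: measurableT_comp.
  move/integrableP: iphi => [_]; rewrite eD ge0_integral_pushforward//.
  exact: measurableT_comp.
by split => //; rewrite -ephi eD integral_pushforward.
Qed.

(** The joint law is the product of the two laws, and Fubini factors the integral. General targets
    serve two uses: two samples of a batch, and [T] itself with two smaller sigma-algebras. *)
Lemma has_mean_indep d (T : measurableType d) d1 (S1 : measurableType d1)
    d2 (S2 : measurableType d2) (P : probability T R) (X1 : T -> S1) (X2 : T -> S2)
    (phi1 : S1 -> R) (phi2 : S2 -> R) a1 a2 :
  measurable_fun setT X1 -> measurable_fun setT X2 ->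
  (forall A B, measurable A -> measurable B ->
     P (X1 @^-1` A `&` X2 @^-1` B) = P (X1 @^-1` A) * P (X2 @^-1` B)) ->
  measurable_fun setT phi1 -> measurable_fun setT phi2 ->
  has_mean P (phi1 \o X1) a1 -> has_mean P (phi2 \o X2) a2 ->
  has_mean P (fun w => phi1 (X1 w) * phi2 (X2 w))%R (a1 * a2)%R.
Proof.
move=> mX1 mX2 X12 mphi1 mphi2 h1 h2.
pose Y1 : {mfun T >-> S1} := HB.pack X1 (isMeasurableFun.Build _ _ _ _ _ mX1).
pose Y2 : {mfun T >-> S2} := HB.pack X2 (isMeasurableFun.Build _ _ _ _ _ mX2).
have mX : measurable_fun setT (fun w => (X1 w, X2 w)) by exact: measurable_fun_pair.
pose Y : {mfun T >-> (S1 * S2)%type} := HB.pack (fun w => (X1 w, X2 w))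
  (isMeasurableFun.Build _ _ _ _ _ mX).
pose m1 : probability S1 R := distribution P Y1.
pose m2 : probability S2 R := distribution P Y2.
pose f (z : S1 * S2) : \bar R := (phi1 z.1 * phi2 z.2)%:E.
have mf : measurable_fun setT f.
  by apply/measurable_EFinP; apply: measurable_funM; exact: measurableT_comp.
(* A measure that factors on rectangles is the product measure. *)
have em g : \int[m1 \x m2]_z g z = \int[distribution P Y]_z g z.
  apply: eq_measure_integral => A mA _.
  by apply: product_measure_unique => // B C mB mC; exact: X12.
have mi1 : m1.-integrable setT (EFin \o phi1).
  by apply: integrable_pushforward => //; [exact/measurable_EFinP|case: h1].
have mi2 : m2.-integrable setT (EFin \o phi2).
  by apply: integrable_pushforward => //; [exact/measurable_EFinP|case: h2].
have e1 : \int[m1]_x (phi1 x)%:E = a1%:E.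
  rewrite /m1 integral_distribution; [by case: h1|exact/measurable_EFinP|by case: h1].
have e2 : \int[m2]_x (phi2 x)%:E = a2%:E.
  rewrite /m2 integral_distribution; [by case: h2|exact/measurable_EFinP|by case: h2].
(* Tonelli: the iterated integral of the absolute value is a product of two finite integrals. *)
have fi : (m1 \x m2).-integrable setT f.
  apply/(integrable12ltyP m1 m2 mf).
  under eq_integral => x _.
    under eq_integral => y _ do rewrite /f /= normrM EFinM.
    rewrite ge0_integralZl//; last by do 2 apply: measurableT_comp => //.
    over.
  rewrite ge0_integralZr//.
  - apply: lte_mul_pinfty; first exact: integral_ge0.
      by rewrite ge0_fin_numE ?integral_ge0//; case/integrableP: mi1.
    by case/integrableP: mi2.
  - by do 2 apply: measurableT_comp => //.
  - exact: integral_ge0.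
have fY : P.-integrable setT (f \o Y).
  apply/integrableP; split; first exact: measurableT_comp.
  move/integrableP: fi => [_]; rewrite em ge0_integral_distribution//.
  exact: measurableT_comp.
split; first exact: fY.
transitivity (\int[distribution P Y]_z f z).
  by rewrite integral_distribution.
rewrite -em -integral12_prod_meas1//.
under eq_integral => x _.
  rewrite /fubini_F.
  under eq_integral => y _ do rewrite /f /= EFinM.
  rewrite integralZl// e2.
  over.
by rewrite integralZr// e1 EFinM.
Qed.
End mean.

(** * Moments of the mini-batch gradient *)

Section batch.
Context {R : realType}.
Local Open Scope ereal_scope.

Lemma has_mean_unique d (T : measurableType d) (P : {measure set T -> \bar R}) h a c :
  has_mean P h a -> has_mean P h c -> a = c.
Proof. by move=> [_ ea] [_]; rewrite ea => -[]. Qed.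

(** Domination by [1 + h ^+ 2]. *)
Lemma has_mean_dominated_sqr d (T : measurableType d) (P : probability T R)
    (h : T -> R) (b : R) :
  measurable_fun setT h -> has_mean P (fun w => h w ^+ 2)%R b -> exists a, has_mean P h a.
Proof.
move=> mh h2; apply: (has_mean_dominated mh _ (has_meanD (has_mean_cst P 1) h2)) => w.
by rewrite ler_norml /=; nra.
Qed.

Context {d} {T : measurableType d} (P : probability T R).
Context {dX} {X : measurableType dX} (D : probability X R).

Lemma iid_pair (I : finType) (Y : I -> T -> X) (i j : I) (A B : set X) :
  iid_with_law P D Y -> i != j -> measurable A -> measurable B ->
  P (Y i @^-1` A `&` Y j @^-1` B) = P (Y i @^-1` A) * P (Y j @^-1` B).
Proof.
move=> [_ _ indep] ij mA mB.
have := indep [set i; j]%SET (fun k => if k == i then A else B).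
rewrite big_setU1/= ?inE// big_set1 eqxx eq_sym (negbTE ij) => <-; last first.
  by move=> k; case: ifP.
congr (P _); apply/seteqP; split => w /=.
  by move=> [Ai Bj] k /=; rewrite !inE => /orP[]/eqP ->; rewrite ?eqxx// eq_sym (negbTE ij).
move=> h; split.
  by have := h i; rewrite /= eqxx; apply; rewrite !inE eqxx.
by have := h j; rewrite /= eq_sym (negbTE ij); apply; rewrite !inE eqxx orbT.
Qed.

Lemma iid_has_mean (I : finType) (Y : I -> T -> X) (phi : X -> R) a i :
  iid_with_law P D Y -> has_mean D phi a -> has_mean P (phi \o Y i) a.
Proof. by move=> [mY YD _]; apply: has_mean_distribution (mY i) (YD i). Qed.

(** In the expanded square the cross terms vanish by independence and centring, and each of the [b]
    diagonal terms contributes [v]. *)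
Lemma iid_has_mean_sum_sqr (b : nat) (Y : 'I_b -> T -> X) (phi : X -> R) v :
  iid_with_law P D Y -> has_mean D phi 0 -> has_mean D (fun x => phi x ^+ 2)%R v ->
  has_mean P (fun w => (\sum_i phi (Y i w)) ^+ 2)%R (b%:R * v)%R.
Proof.
move=> iidY h1 h2.
have hij i j : has_mean P (fun w => phi (Y i w) * phi (Y j w))%R (if j == i then v else 0)%R.
  case: eqVneq => [->|ij]; first exact: (iid_has_mean i iidY h2).
  have [mY _ _] := iidY; rewrite -[X in has_mean _ _ X](mulr0 (0 : R)%R).
  apply: (has_mean_indep (phi1 := phi) (phi2 := phi) (mY i) (mY j));
    try exact: (has_mean_measurable h1).
  - by move=> A B mA mB; apply: iid_pair => //; rewrite eq_sym.
  - exact: (iid_has_mean i iidY h1).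
  - exact: (iid_has_mean j iidY h1).
have -> : (b%:R * v = \sum_(i < b) \sum_(j < b) (if j == i then v else 0))%R.
  under eq_bigr do rewrite -big_mkcond big_pred1_eq.
  by rewrite sumr_const card_ord mulr_natl.
apply: has_mean_ext (has_mean_sum _ (fun i => has_mean_sum _ (hij i))) => w.
by rewrite expr2 mulr_suml; apply: eq_bigr => i _; rewrite mulr_sumr.
Qed.

Lemma measurable_mx_entry m n (i : 'I_m) (j : 'I_n) :
  measurable_fun setT (fun A : 'M[R]_(m, n) => A i j).
Proof.
by move=> _ B mB; apply: sub_sigma_algebra; exists (i, j) => //; exists B.
Qed.

(** Splitting the total variance into entrywise variances [v i j] lets the batch average be treated
    by scalar lemmas. *)
Lemma stochastic_gradient_coord m n (f : 'M[R]_(m, n) -> R) G sigma (W : 'M[R]_(m, n)) :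
  stochastic_gradient f D G sigma ->
  exists v : 'I_m -> 'I_n -> R,
    (\sum_i \sum_j v i j <= sigma ^+ 2)%R /\
    forall i j, has_mean D (fun x => G W x i j - grad f W i j)%R 0 /\
                has_mean D (fun x => (G W x i j - grad f W i j) ^+ 2)%R (v i j).
Proof.
move=> [mG unb var].
have mGW i j : measurable_fun setT (fun x => G W x i j).
  apply: (measurableT_comp (measurable_mx_entry i j)).
  exact: (measurable_fun_pair2 W mG).
pose Y i j x := (G W x i j - grad f W i j)%R.
have mY i j : measurable_fun setT (Y i j) by apply: measurable_funB.
have mY2 i j : measurable_fun setT (fun x => Y i j x ^+ 2)%R by apply: measurable_funX.
pose F x := (\sum_i \sum_j Y i j x ^+ 2)%R.
have F0 x : (0 <= F x)%R by apply: sumr_ge0 => i _; apply: sumr_ge0 => j _; exact: sqr_ge0.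
have mF : measurable_fun setT F.
  by apply: measurable_sum => i; apply: measurable_sum => j.
have eF : (fun x => frobenius_norm (G W x - grad f W) ^+ 2)%R = F.
  apply/funext => x; rewrite frobenius_sqr; apply: eq_bigr => i _.
  by apply: eq_bigr => j _; rewrite /Y !mxE.
have := var W; rewrite eF unlock => Fle.
(* The variance bound makes the nonnegative [F] integrable, and [F] dominates every squared
   entry. *)
have iF : D.-integrable setT (EFin \o F).
  apply/integrableP; split; first exact/measurable_EFinP.
  apply: le_lt_trans (ltry (sigma ^+ 2)); apply: le_trans Fle.
  by rewrite (eq_integral (fun x => (F x)%:E)) // => x _; rewrite /= ger0_norm ?F0.
have hF : has_mean D F (fine (\int[D]_x (F x)%:E)).
  by split => //; rewrite fineK//; exact: integrable_fin_num.
have hY2 i j : exists a, has_mean D (fun x => Y i j x ^+ 2)%R a.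
  apply: has_mean_dominated hF => // x; rewrite ger0_norm ?sqr_ge0//.
  rewrite /F (bigD1 i)//= (bigD1 j)//= -addrA lerDl addr_ge0//.
    by apply: sumr_ge0 => k _; exact: sqr_ge0.
  by apply: sumr_ge0 => k _; apply: sumr_ge0 => l _; exact: sqr_ge0.
pose v i j := projT1 (cid (hY2 i j)).
have hv i j : has_mean D (fun x => Y i j x ^+ 2)%R (v i j) by exact: (projT2 (cid (hY2 i j))).
exists v; split.
  rewrite -lee_fin.
  have [_ <-] := has_mean_sum (index_enum _) (fun i => has_mean_sum (index_enum _) (hv i)).
  exact: Fle.
move=> i j; split; last exact: hv.
(* The second moment gives integrability; unbiasedness then identifies the mean as 0. *)
have [a ha] := has_mean_dominated_sqr (mY i j) (hv i j).
suff <- : a = 0%R by [].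
have := has_meanD ha (has_mean_cst D (grad f W i j)).
move/(has_mean_ext (fun x => subrK (grad f W i j) (G W x i j)))/has_mean_expectation.
by rewrite unb => -[] /eqP; rewrite -subr_eq subrr => /eqP <-.
Qed.

Lemma measurable_direction_noise d' (S : measurableType d') m n
    (A : 'M[R]_(m, n)) (E : S -> 'M[R]_(m, n)) :
  (forall i j, measurable_fun setT (fun w => E w i j)) ->
  measurable_fun setT (fun w => direction_noise A (E w)).
Proof.
move=> mE; apply: measurable_funD; first apply: measurable_funB.
- apply: measurable_sum => i; apply: measurable_sum => j.
  exact: measurableT_comp.
- apply: measurable_sum => i; apply: measurable_sum => j.
  exact: measurable_funM.
- apply: measurable_funM => //.
  apply: (measurableT_comp (continuous_measurable_fun (@sqrt_continuous R))).
  by apply: measurable_sum => i; apply: measurable_sum => j; exact: measurable_funX.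
Qed.

Lemma measurable_batch_grad d' (S : measurableType d') m n b
    (G : 'M[R]_(m, n) -> X -> 'M[R]_(m, n)) (W : 'M[R]_(m, n))
    (Y : 'I_b -> S -> X) (j : 'I_m) (k : 'I_n) :
  measurable_fun [set: 'M[R]_(m, n) * X] (fun z => G z.1 z.2) ->
  (forall i, measurable_fun setT (Y i)) ->
  measurable_fun setT (fun w => batch_grad G W (Y ^~ w) j k).
Proof.
move=> mG mY.
have -> : (fun w => batch_grad G W (Y ^~ w) j k) =
    (fun w => b%:R^-1 * \sum_(i < b) G W (Y i w) j k)%R.
  by apply/funext => w; rewrite mxE summxE.
apply: measurable_funM => //; apply: measurable_sum => i.
apply: (measurableT_comp (measurable_mx_entry j k)).
exact: (measurableT_comp (measurable_fun_pair2 W mG)).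
Qed.

(** The right-hand side is quadratic plus linear in [E], so its mean is computable. If the squared
    norm of [E] has mean at most [s ^+ 2], the parenthesis with [s / 2] has mean at most [s]; this
    takes the place of Jensen's inequality for the square root. *)
Lemma direction_noise_le m n (A E : 'M[R]_(m, n)) (s : R) : (0 < s)%R ->
  (direction_noise A E <= (Num.sqrt (m * n)%:R + 2 / 3)
     * (frobenius_norm E ^+ 2 * (2 * s)^-1 + s / 2) - mxdot (sign_mx A) E)%R.
Proof.
move=> s0.
(* AM-GM: |E| <= |E|^2 / (2 s) + s / 2 *)
have -> : (frobenius_norm E ^+ 2 * (2 * s)^-1 + s / 2 =
    (frobenius_norm E - s) ^+ 2 * (2 * s)^-1 + frobenius_norm E)%R.
  by field; rewrite gt_eqF.
have := norm11_le_frobenius E; rewrite /direction_noise; set q := Num.sqrt _ => h.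
have q0 : (0 <= q + 2 / 3)%R by rewrite addr_ge0 ?sqrtr_ge0// divr_ge0.
have p0 : (0 <= (frobenius_norm E - s) ^+ 2 * (2 * s)^-1)%R.
  by rewrite mulr_ge0 ?sqr_ge0// invr_ge0 mulr_ge0// ltW.
by have := mulr_ge0 q0 p0; lra.
Qed.

(** At a fixed [W] the sign of the gradient is a constant matrix, so the signed term has mean zero;
    averaging over the batch brings the variance down to at most [sigma ^+ 2 / b%:R], and
    [direction_noise_le] applies. *)
Lemma has_mean_direction_noise m n b (f : 'M[R]_(m, n) -> R)
    (G : 'M[R]_(m, n) -> X -> 'M[R]_(m, n)) sigma (W : 'M[R]_(m, n))
    (Y : 'I_b -> T -> X) (s : R) :
  stochastic_gradient f D G sigma -> iid_with_law P D Y -> (0 < b)%N ->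
  (0 < s)%R -> (sigma ^+ 2 / b%:R <= s ^+ 2)%R ->
  exists a, has_mean P (fun w => direction_noise (grad f W)
                          (batch_grad G W (Y ^~ w) - grad f W)) a /\
    (a <= (Num.sqrt (m * n)%:R + 2 / 3) * s)%R.
Proof.
move=> sg iidY b0 s0 sb.
have [mG _ _] := sg; have [mY _ _] := iidY.
have b0' : (0 < b%:R :> R)%R by rewrite ltr0n.
have [v [vs hv]] := stochastic_gradient_coord W sg.
pose E w := (batch_grad G W (Y ^~ w) - grad f W)%R.
have eE j k w : E w j k = (b%:R^-1 * \sum_i (G W (Y i w) j k - grad f W j k))%R.
  rewrite mxE [batch_grad _ _ _ j k]mxE summxE sumrB mulrBr sumr_const card_ord.
  by rewrite -[X in (_ - _ * X)%R]mulr_natl mulKf ?gt_eqF// !mxE.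
have hE1 : has_mean P (fun w => mxdot (sign_mx (grad f W)) (E w)) 0%R.
  have -> : (0%R : R) = (\sum_(j < m) \sum_(k < n)
      (sign_mx (grad f W) j k * (b%:R^-1 * \sum_(i < b) 0)))%R.
    by rewrite big1// => j _; rewrite big1// => k _; rewrite big1 ?mulr0.
  apply: has_mean_sum => j; apply: has_mean_sum => k; apply: has_meanZ.
  apply: has_mean_ext (fun w => esym (eE j k w)) _; apply: has_meanZ.
  by apply: has_mean_sum => i; have [h _] := hv j k; exact: (iid_has_mean i iidY h).
have hE2 : has_mean P (fun w => frobenius_norm (E w) ^+ 2)%R
    (\sum_j \sum_k (b%:R^-1 ^+ 2 * (b%:R * v j k)))%R.
  apply: has_mean_ext (fun w => esym (frobenius_sqr (E w))) _.
  apply: has_mean_sum => j; apply: has_mean_sum => k.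
  have [h1 h2] := hv j k.
  apply: has_mean_ext (has_meanZ (b%:R^-1 ^+ 2) (iid_has_mean_sum_sqr iidY h1 h2)) => w.
  by rewrite eE exprMn.
have hb := has_meanB (has_meanZ (Num.sqrt (m * n)%:R + 2 / 3)
  (has_meanD (has_meanZ (2 * s)^-1 hE2) (has_mean_cst P (s / 2)))) hE1.
pose H w := direction_noise (grad f W) (E w).
have mH : measurable_fun setT H.
  apply: measurable_direction_noise => j k; under eq_fun do rewrite mxE.
  by apply: measurable_funD => //; exact: measurable_batch_grad.
have hle w : (H w <= (Num.sqrt (m * n)%:R + 2 / 3)
    * ((2 * s)^-1 * frobenius_norm (E w) ^+ 2 + s / 2) - mxdot (sign_mx (grad f W)) (E w))%R.
  by rewrite [X in (_ <= _ * (X + _) - _)%R]mulrC; exact: direction_noise_le.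
have hnle w : (`|H w| <= (Num.sqrt (m * n)%:R + 2 / 3)
    * ((2 * s)^-1 * frobenius_norm (E w) ^+ 2 + s / 2) - mxdot (sign_mx (grad f W)) (E w))%R.
  by rewrite ger0_norm ?direction_noise_ge0.
have [a ha] := has_mean_dominated mH hnle hb.
exists a; split; first exact: ha.
apply: le_trans (has_mean_le ha hb hle) _; rewrite subr0.
rewrite ler_wpM2l ?addr_ge0 ?sqrtr_ge0//.
have -> : (\sum_j \sum_k b%:R^-1 ^+ 2 * (b%:R * v j k) = (\sum_j \sum_k v j k) / b%:R)%R.
  rewrite mulr_suml; apply: eq_bigr => j _; rewrite mulr_suml; apply: eq_bigr => k _.
  by field; rewrite gt_eqF.
have h : ((\sum_j \sum_k v j k) / b%:R <= s ^+ 2)%R.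
  by apply: le_trans sb; rewrite ler_pM2r// invr_gt0.
have h2 : ((2 * s)^-1 * ((\sum_j \sum_k v j k) / b%:R) <= (2 * s)^-1 * s ^+ 2)%R.
  by rewrite ler_wpM2l// invr_ge0 mulr_ge0// ltW.
have h3 : ((2 * s)^-1 * s ^+ 2 = s / 2)%R by field; rewrite gt_eqF.
lra.
Qed.
End batch.

(** * Runs of the algorithm *)

Section run.
Context {R : realType}.

Lemma measurable_mxP d (S : measurableType d) m n (F : S -> 'M[R]_(m, n)) :
  (forall i j, measurable_fun setT (fun w => F w i j)) -> measurable_fun setT F.
Proof.
move=> mF; apply: (@measurability _ _ _ _ _ _ (\bigcup_(ij in [set: 'I_m * 'I_n])
   preimage_set_system setT (fun A : 'M[R]_(m, n) => A ij.1 ij.2) measurable)) => //.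
move=> _ [_ [[i j] _ [B mB <-]] <-].
rewrite !setTI -[X in measurable X]setTI; exact: mF.
Qed.

(** Equality with [v] is the vanishing of the real function [norm11 (F w - v)]. The source will be
    [T] with the sigma-algebra of the past. *)
Lemma measurable_mx_eq d (S : measurableType d) m n (F : S -> 'M[R]_(m, n)) (v : 'M[R]_(m, n)) :
  (forall i j, measurable_fun setT (fun w => F w i j)) -> measurable [set w | F w = v].
Proof.
move=> mF.
have mN : measurable_fun setT (fun w => norm11 (F w - v)).
  apply: measurable_sum => i; apply: measurable_sum => j.
  apply: measurableT_comp => //; under eq_fun do rewrite mxE.
  exact: measurable_funD.
rewrite (_ : [set w | F w = v] = setT `&` (fun w => norm11 (F w - v)) @^-1` [set 0]).
  exact: mN.
rewrite setTI; apply/seteqP; split => w /=.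
  by move=> ->; rewrite subrr /norm11 big1// => i _; rewrite big1// => j _; rewrite mxE normr0.
move=> h; apply/eqP; rewrite -subr_eq0; apply/eqP/frobenius_eq0/eqP.
by rewrite eq_le frobenius_ge0 -h frobenius_le_norm11.
Qed.

Lemma measurable_sgr : measurable_fun setT (Num.sg : R -> R).
Proof.
have -> : (Num.sg : R -> R) =
    (fun x => if x == 0 then 0 else if x < 0 then -1 else 1) by [].
apply: measurable_fun_ifT => //; first exact: measurable_fun_eqr.
by apply: measurable_fun_ifT => //; exact: measurable_fun_ltr.
Qed.

(** Exactly one indicator is nonzero at [w]. This turns a function of a finitely valued [x] into a
    finite sum whose mean can be taken term by term. *)
Lemma sum_indicator (S : Type) (V : eqType) (F : V -> R) (x : S -> V) (s : seq V) w :
  uniq s -> x w \in s -> \sum_(v <- s) \1_[set w | x w = v] w * F v = F (x w).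
Proof.
move=> us xs; rewrite (bigD1_seq (x w))//= big1 ?addr0.
  by rewrite indicE mem_set// mul1r.
by move=> v vx; rewrite indicE memNset ?mul0r//= => e; rewrite e eqxx in vx.
Qed.

Context {dT} {T : measurableType dT} (P : probability T R).

Lemma has_mean_indic (A : set T) : measurable A -> has_mean P \1_A (fine (P A)).
Proof.
move=> mA; split; first exact: integrable_indic.
by have := expectation_indic P mA; rewrite unlock => ->; rewrite fineK// fin_num_measure.
Qed.

Context {dX} {X : measurableType dX} (D : probability X R).
Context {m n r p b : nat} (Z : mlorc_vars (R := R) T X m n r p b).
Context (f : 'M[R]_(m, n) -> R) (G : 'M[R]_(m, n) -> X -> 'M[R]_(m, n)).
Context (W1 : 'M[R]_(m, n)) (alpha beta1 beta2 sigma : R).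
Hypothesis ML : is_mlorc_lion P D G W1 alpha beta1 beta2 Z.
Hypothesis SG : stochastic_gradient f D G sigma.

(** Generators are named apart from the events they generate so that [g_sigma_algebraType] can make
    [T], with the smaller sigma-algebra, a measurable type; measurability in the past is then plain
    [measurable_fun]. *)
Definition batch_generators t : set (set T) :=
  \bigcup_(i in [set: 'I_b]) sigma_of (sample Z t i).

Definition past_generators t : set (set T) :=
  \bigcup_(s in [set s | (0 < s < t)%N])
    (batch_events Z s `|` sigma_of (test_mx Z s) `|`
     sigma_of (mom_u Z s) `|` sigma_of (mom_s Z s) `|` sigma_of (mom_v Z s)).

Lemma sigma_of_measurable d (S : measurableType d) (Y : T -> S) :
  measurable_fun setT Y -> sigma_of Y `<=` measurable.
Proof. by move=> mY _ [B mB <-]; exact: mY. Qed.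

Lemma batch_events_measurable t : (0 < t)%N -> batch_events Z t `<=` measurable.
Proof.
move=> t0; apply: smallest_sub; first exact: sigma_algebra_measurable.
move=> A [i _]; apply: sigma_of_measurable.
by have [mY _ _] := ml_sample ML t0.
Qed.

Lemma past_events_measurable t : past_events Z t `<=` measurable.
Proof.
apply: smallest_sub; first exact: sigma_algebra_measurable.
move=> A [s /andP[s0 _]]; have [mu ms mv] := ml_factors_measurable ML s0.
case=> [[[[|]|]|]|].
- exact: batch_events_measurable.
- apply: sigma_of_measurable; apply: measurable_mxP => i j.
  by have [h _ _] := ml_gauss ML s0; exact: (h (i, j)).
- exact: sigma_of_measurable.
- exact: sigma_of_measurable.
- exact: sigma_of_measurable.
Qed.

Lemma past_events_mono t : past_events Z t `<=` past_events Z t.+1.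
Proof.
apply: sub_sigma_algebra2 => A [s /andP[s0 st] h]; exists s => //=.
by rewrite s0 ltnS ltnW.
Qed.

Local Notation past t := (g_sigma_algebraType (past_generators t)).

Lemma sample_past t i : (0 < t)%N ->
  measurable_fun setT (sample Z t i : past t.+1 -> X).
Proof.
move=> t0 _ B mB; apply: sub_sigma_algebra; exists t; first by rewrite /= t0 ltnSn.
by do 4 left; apply: sub_sigma_algebra; exists i => //; exists B.
Qed.

(** For positive [t] the three factors are generators of the past; those of index 0 are not, but
    there the product is constantly zero. *)
Lemma mom_low_past t i j :
  measurable_fun setT ((fun w => mom_low Z t w i j) : past t.+2 -> R).
Proof.
have [->|t0] := posnP t.
  under eq_fun do rewrite /mom_low (ml_init_u ML) mul0mx mul0mx mxE.
  exact: measurable_cst.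
have lt : (0 < t < t.+2)%N by rewrite t0 ltnS leqnSn.
have mu k l : measurable_fun setT ((fun w => mom_u Z t w k l) : past t.+2 -> R).
  apply: (measurableT_comp (measurable_mx_entry k l)) => _ B mB.
  by apply: sub_sigma_algebra; exists t => //; left; left; right; exists B.
have ms k l : measurable_fun setT ((fun w => mom_s Z t w k l) : past t.+2 -> R).
  apply: (measurableT_comp (measurable_mx_entry k l)) => _ B mB.
  by apply: sub_sigma_algebra; exists t => //; left; right; exists B.
have mv k l : measurable_fun setT ((fun w => mom_v Z t w k l) : past t.+2 -> R).
  apply: (measurableT_comp (measurable_mx_entry k l)) => _ B mB.
  by apply: sub_sigma_algebra; exists t => //; right; exists B.
under eq_fun do rewrite mxE; apply: measurable_sum => k.
under eq_fun do rewrite [X in X * _]mxE [X in _ * X]mxE.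
by apply: measurable_funM => //; apply: measurable_sum => l; exact: measurable_funM.
Qed.

(* The increments are -alpha times sign matrices, of which there are finitely many. *)
Lemma iter_W_finite t : exists s : seq 'M[R]_(m, n),
  (forall w, iter_W Z t.+1 w \in s) /\
  (forall v, past_events Z t.+1 [set w | iter_W Z t.+1 w = v]).
Proof.
elim: t => [|t [s [Ws Wm]]].
  exists [:: W1]; split => [w|v]; first by rewrite (ml_init_W ML) inE.
  have [->|vW] := eqVneq v W1.
    rewrite (_ : [set _ | _] = setT); first exact: (@measurableT _ (past 1)).
    by apply/seteqP; split => // w _ /=; rewrite (ml_init_W ML).
  rewrite (_ : [set _ | _] = set0); first exact: (@measurable0 _ (past 1)).
  by apply/seteqP; split => // w /=; rewrite (ml_init_W ML) => e; rewrite e eqxx in vW.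
(* The digits 0, 1, 2 encode the signs -1, 0, 1. *)
pose sgn (E : 'M['I_3]_(m, n)) : 'M[R]_(m, n) := map_mx (fun k : 'I_3 => k%:R - 1) E.
exists [seq u - alpha *: sgn E | u <- s, E <- enum {: 'M['I_3]_(m, n)}]; split.
  move=> w; apply/allpairsP; set c := dir_c Z t.+1 w.
  exists (iter_W Z t.+1 w, \matrix_(i, j)
    inord (if c i j == 0 then 1 else if c i j < 0 then 0 else 2)).
  split => //=; first by rewrite mem_enum.
  rewrite (ml_step ML)//; congr (_ - _ *: _); apply/matrixP => i j; rewrite !mxE inordK.
    by rewrite /Num.sg; case: ifP => _; [rewrite subrr|case: ifP => _; rewrite ?sub0r//; lra].
  by case: ifP => // _; case: ifP.
move=> v.
pose c u w := beta1 *: mom_low Z t w + (1 - beta1) *: batch_grad G u (fun i => sample Z t.+1 i w).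
(* Once [iter_W Z t.+1] is fixed at [u], the gradient is evaluated at a constant point, and the
   direction depends only on samples and factors in the past of step [t.+2]. *)
have -> : [set w | iter_W Z t.+2 w = v] = \big[setU/set0]_(u <- s)
    ([set w | iter_W Z t.+1 w = u] `&` [set w | u - alpha *: sign_mx (c u w) = v]).
  have cE w : dir_c Z t.+1 w = c (iter_W Z t.+1 w) w by rewrite (ml_dir ML)// (ml_grad ML).
  rewrite -bigcup_seq; apply/seteqP; split => w /=.
    by rewrite (ml_step ML (ltn0Sn t)) cE => h; exists (iter_W Z t.+1 w); [exact: Ws | split].
  by move=> [u us [<- <-]]; rewrite (ml_step ML (ltn0Sn t)) cE.
apply: (@bigsetU_measurable _ (past t.+2)) => u _.
apply: (@measurableI _ (past t.+2)); first exact: (past_events_mono (Wm u)).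
apply: (@measurable_mx_eq _ (past t.+2)) => i j.
rewrite (_ : (fun w => _) = (fun w => u i j - alpha * Num.sg (beta1 * mom_low Z t w i j +
    (1 - beta1) * batch_grad G u (fun k => sample Z t.+1 k w) i j))); last first.
  apply/funext => w; rewrite /c; move: (mom_low Z t w) (batch_grad _ _ _) => A B.
  by rewrite !mxE.
apply: measurable_funB => //; apply: measurable_funM => //.
apply: (measurableT_comp measurable_sgr); apply: measurable_funD; apply: measurable_funM => //.
  exact: mom_low_past.
have [mG _ _] := SG.
by apply: (@measurable_batch_grad R dX X _ (past t.+2) m n b G u (sample Z t.+1) i j mG) => k;
  exact: sample_past.
Qed.

(** Finitely many values make this a finite sum for an arbitrary [F], measurable or not. *)
Lemma has_mean_iter_W (F : 'M[R]_(m, n) -> R) t :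
  exists a, has_mean P (fun w => F (iter_W Z t.+1 w)) a.
Proof.
have [s [Ws Wm]] := iter_W_finite t.
pose A v := [set w | iter_W Z t.+1 w = v].
exists (\sum_(v <- undup s) F v * fine (P (A v))).
apply: has_mean_ext (has_mean_sum (undup s) (fun v => has_meanZ (F v)
  (has_mean_indic (past_events_measurable (Wm v))))) => w.
under eq_bigr do rewrite mulrC.
by rewrite sum_indicator ?undup_uniq ?mem_undup.
Qed.

(** [has_mean_indep] for the identity map taken twice, into [T] with the sigma-algebra of the past
    and into [T] with that of the batch; freshness of the batch is the independence of these two
    maps. *)
Lemma has_mean_fresh t (A : set T) (h : T -> R) a : (0 < t)%N ->
  past_events Z t A ->
  measurable_fun setT (h : g_sigma_algebraType (batch_generators t) -> R) ->
  has_mean P h a -> has_mean P (fun w => \1_A w * h w) (fine (P A) * a).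
Proof.
move=> t0 pA mh hh.
pose B := g_sigma_algebraType (batch_generators t).
have mP : measurable_fun setT (id : T -> past t).
  by move=> _ C mC; rewrite setTI; exact: past_events_measurable mC.
have mB : measurable_fun setT (id : T -> B).
  by move=> _ C mC; rewrite setTI; exact: batch_events_measurable mC.
apply: (@has_mean_indep R _ T _ (past t) _ B P id id \1_A h) => //.
- by move=> C1 C2 mC1 mC2; exact: (ml_sample_fresh ML t0).
- by apply: has_mean_indic; exact: past_events_measurable pA.
Qed.

(** Where the iterate equals [v], the noise is that of the fixed point [v], and its mean factors by
    [has_mean_fresh]. The mean is thus an average of the [a v], weighted by the probabilities of
    these events. *)
Lemma has_mean_iter_noise t (s : R) : (0 < b)%N -> 0 < s -> sigma ^+ 2 / b%:R <= s ^+ 2 ->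
  exists a, has_mean P (fun w => direction_noise (grad f (iter_W Z t.+1 w))
                          (grad_g Z t.+1 w - grad f (iter_W Z t.+1 w))) a /\
    a <= (Num.sqrt (m * n)%:R + 2 / 3) * s.
Proof.
move=> b0 s0 sb.
have [l [Wl Wm]] := iter_W_finite t.
have iidY := ml_sample ML (ltn0Sn t).
pose h v w := direction_noise (grad f v) (batch_grad G v (fun i => sample Z t.+1 i w) - grad f v).
have [a H] := choice (fun v => has_mean_direction_noise v SG iidY b0 s0 sb).
have ha v : has_mean P (h v) (a v) by have [] := H v.
have ale v : a v <= (Num.sqrt (m * n)%:R + 2 / 3) * s by have [] := H v.
pose A v := [set w | iter_W Z t.+1 w = v].
have mA v : measurable (A v) by exact: past_events_measurable (Wm v).
have mh v : measurable_fun setT (h v : g_sigma_algebraType (batch_generators t.+1) -> R).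
  apply: (@measurable_direction_noise R _ (g_sigma_algebraType (batch_generators t.+1))) => j k.
  rewrite (_ : (fun w => _) = (fun w =>
      batch_grad G v (fun i => sample Z t.+1 i w) j k - grad f v j k)).
    apply: measurable_funB => //; have [mG _ _] := SG.
    apply: (@measurable_batch_grad R dX X _ (g_sigma_algebraType (batch_generators t.+1))
      m n b G v (sample Z t.+1) j k mG) => i _ B mB.
    by apply: sub_sigma_algebra; exists i => //; exists B.
  by apply/funext => w; rewrite mxE [in X in _ + X]mxE.
exists (\sum_(v <- undup l) fine (P (A v)) * a v); split.
  apply: has_mean_ext (has_mean_sum (undup l)
    (fun v => has_mean_fresh (ltn0Sn t) (Wm v) (mh v) (ha v))) => w.
  rewrite (ml_grad ML)//.
  by apply: (@sum_indicator _ _ (h ^~ w) (iter_W Z t.+1)); rewrite ?undup_uniq ?mem_undup.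
have hsum : \sum_(v <- undup l) fine (P (A v)) = 1.
  apply: has_mean_unique (has_mean_cst P 1).
  apply: has_mean_ext (has_mean_sum (undup l) (fun v => has_mean_indic (mA v))) => w.
  rewrite /= -(@sum_indicator _ _ (fun=> 1) (iter_W Z t.+1) (undup l) w) ?undup_uniq ?mem_undup//.
  by apply: eq_bigr => v _; rewrite mulr1.
(* The weights sum to one, so a common bound on the [a v] bounds their average. *)
set c := (X in _ <= X); have -> : c = \sum_(v <- undup l) fine (P (A v)) * c.
  by rewrite -mulr_suml hsum mul1r.
by apply: ler_sum => v _; apply: ler_wpM2l; [exact: fine_ge0|exact: ale].
Qed.
End run.

(** * From the pathwise inequality to expectations *)

Section main_bound.
Context {R : realType}.

Lemma rsvd_gamma_ge1 (r p : nat) : (2 <= p)%N -> 1 <= rsvd_gamma r p :> R.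
Proof.
move=> p2; rewrite -sqrtr1 ler_wsqrtr// lerDl divr_ge0// subr_ge0.
by rewrite ler1n ltnW.
Qed.

(** The common source of both bounds. The mean decrease [e] of [f] is a real number of either sign
    and enters without being estimated. *)
Lemma mlorc_lion_avg_le dT (T : measurableType dT) (P : probability T R)
    dX (X : measurableType dX) (D : probability X R) (m n r p b : nat)
    (Z : mlorc_vars (R := R) T X m n r p b) (f : 'M[R]_(m, n) -> R)
    (G : 'M[R]_(m, n) -> X -> 'M[R]_(m, n))
    (W1 : 'M[R]_(m, n)) (L alpha beta1 beta2 sigma : R) (N : nat) :
  0 <= L -> smooth_bounded_below f L -> 0 <= sigma -> stochastic_gradient f D G sigma ->
  0 < alpha -> (0 < b)%N -> 0 <= beta1 < 1 -> 0 <= beta2 < 1 ->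
  3 * beta1 * Num.sqrt (m * n)%:R <= 1 - beta1 ->
  is_mlorc_lion P D G W1 alpha beta1 beta2 Z -> (0 < N)%N ->
  exists a e : R,
  [/\ avg_grad_norm P f (iter_W Z) N = a%:E,
      has_mean P (fun w => f (iter_W Z 1 w) - f (iter_W Z N.+1 w)) e &
      a <= 3 * (e / (alpha * N%:R) + L * alpha / 2 * (m * n)%:R
                + (Num.sqrt (m * n)%:R + 2 / 3) * (sigma / Num.sqrt b%:R))].
Proof.
move=> L0 sf s0 SG a0 b0 b1 b2 b1d ML N0.
have [e1 he1] := has_mean_iter_W ML SG f 0.
have [e2 he2] := has_mean_iter_W ML SG f N.
have he := has_meanB he1 he2.
have [g hg] := choice (has_mean_iter_W ML SG (fun W => norm11 (grad f W))).
have N0' : 0 < N%:R :> R by rewrite ltr0n.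
have b0' : 0 < Num.sqrt b%:R :> R by rewrite sqrtr_gt0 ltr0n.
have q0 : 0 <= Num.sqrt (m * n)%:R + 2 / 3 :> R by rewrite addr_ge0 ?sqrtr_ge0.
have q1 : 0 < Num.sqrt (m * n)%:R + 2 / 3 :> R by rewrite ltr_wpDl ?sqrtr_ge0.
exists (N%:R^-1 * \sum_(0 <= t < N) g t), (e1 - e2); split => //.
  rewrite /avg_grad_norm big_add1 EFinM -sumEFin; congr (_ * _)%E.
  by apply: eq_bigr => t _; exact: has_mean_expectation (hg t).
(* AM-GM needs a positive s, but sigma may be 0. *)
apply/ler_addgt0Pr => eps eps0.
(* The second summand is the share of [eps] that the factor [3 * (Num.sqrt (m * n)%:R + 2 / 3)]
   turns back into [eps]. *)
pose s := sigma / Num.sqrt b%:R + eps / (3 * (Num.sqrt (m * n)%:R + 2 / 3)).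
have sq0 : 0 <= sigma / Num.sqrt b%:R by rewrite divr_ge0// ltW.
have e0 : 0 < eps / (3 * (Num.sqrt (m * n)%:R + 2 / 3)) by rewrite divr_gt0// mulr_gt0.
have sgt0 : 0 < s by rewrite ltr_wpDl.
have sb : sigma ^+ 2 / b%:R <= s ^+ 2.
  rewrite -[b%:R]sqr_sqrtr ?ler0n// -expr_div_n; apply: lerXn2r.
  - exact: sq0.
  - exact: ltW.
  - by rewrite /s lerDl ltW.
have [h hh] := choice (fun t => has_mean_iter_noise ML SG t b0 sgt0 sb).
have hle t : h t <= (Num.sqrt (m * n)%:R + 2 / 3) * s by have [] := hh t.
have path w := @lion_pathwise R m n f L alpha beta1 beta2 (fun t => iter_W Z t w)
  (fun t => grad_g Z t w) (fun t => mom_low Z t w) N sf L0 a0 b1 b2 b1d.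
have lhs := has_mean_sum (index_iota 0 N) hg.
have rhs := has_meanZ 3 (has_meanD (has_meanD (has_meanZ alpha^-1 he)
  (has_mean_cst P (N%:R * (L * alpha / 2 * (m * n)%:R))))
  (has_mean_sum (index_iota 0 N) (fun t => proj1 (hh t)))).
have sumh : \sum_(0 <= t < N) h t <= N%:R * ((Num.sqrt (m * n)%:R + 2 / 3) * s).
  apply: le_trans (ler_sum _ (fun t _ => hle t)) _.
  by rewrite sumr_const_nat subn0 [leRHS]mulr_natl.
(* The pathwise inequality is integrated; its momentum hypothesis is the contraction property of the
   randomized SVD. *)
rewrite mulrC ler_pdivrMr//; apply: le_trans (has_mean_le lhs rhs _) _.
  move=> w; have := path w; rewrite !big_add1/= [_ / alpha]mulrC; apply.
  - by rewrite /mom_low (ml_init_u ML) !mul0mx.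
  - move=> t; have /= <- := ml_mom ML (ltn0Sn t) w.
    exact: frobenius_RSVD (ml_rsvd ML (ltn0Sn t) w).
  - by move=> t; have /= <- := ml_dir ML (ltn0Sn t) w; exact: ml_step ML _ _ _.
have -> : (3 * ((e1 - e2) / (alpha * N%:R) + L * alpha / 2 * (m * n)%:R
     + (Num.sqrt (m * n)%:R + 2 / 3) * (sigma / Num.sqrt b%:R)) + eps) * N%:R =
   3 * (alpha^-1 * (e1 - e2) + N%:R * (L * alpha / 2 * (m * n)%:R)
      + N%:R * ((Num.sqrt (m * n)%:R + 2 / 3) * s)).
  by rewrite /s; field; rewrite !gt_eqF//=; lra.
by rewrite ler_pM2l// lerD2l.
Qed.
End main_bound.

(** * Constants and step size *)

Section parameters.
Context {R : realType}.

(** With [q] the root of [m * n], [rsvd_gamma r p >= 1] gives [4 * beta1 * q <= 1]. Since [q >= 1],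
    both [beta1 <= 1 / 4] and [3 * beta1 * q + beta1 <= 4 * beta1 * q] follow. *)
Lemma lion_parameters (m n r p : nat) (beta1 : R) :
  (1 <= m)%N -> (1 <= n)%N -> (2 <= p)%N ->
  0 <= beta1 <= 1 / (4 * rsvd_gamma r p * Num.sqrt (m * n)%:R) ->
  [/\ 1 <= Num.sqrt (m * n)%:R :> R, beta1 <= 1 / 4 &
      3 * beta1 * Num.sqrt (m * n)%:R <= 1 - beta1].
Proof.
move=> m1 n1 p2 /andP[b0]; have g1 := @rsvd_gamma_ge1 R r p p2.
have q1 : 1 <= Num.sqrt (m * n)%:R :> R by rewrite -{1}sqrtr1 ler_wsqrtr// ler1n muln_gt0 m1.
set q := Num.sqrt _ in q1 *; set g := rsvd_gamma _ _ in g1 *.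
have g0 : 0 < g by apply: lt_le_trans g1.
have q0 : 0 < q by apply: lt_le_trans q1.
rewrite ler_pdivlMr ?mulr_gt0// => h.
have bq : beta1 * q * 1 <= beta1 * q * g by rewrite ler_wpM2l// mulr_ge0// ltW.
have b : beta1 * 1 <= beta1 * q by rewrite ler_wpM2l.
by split => //; lra.
Qed.

(** The share of [q] goes into the term with [gamma]. The remaining 2/3 goes into the last term,
    whose coefficient is at least 3/4 because [beta1 <= 1 / 4]; the factor [1 - beta2] under the
    root only enlarges that term. *)
Lemma noise_coefficient_le (q gamma sigma b' beta1 beta2 : R) :
  1 <= q -> 1 <= gamma -> 0 <= sigma -> 0 < b' -> 0 <= beta1 <= 1 / 4 -> 0 <= beta2 < 1 ->
  (q + 2 / 3) * (sigma / Num.sqrt b') <=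
  gamma * (sigma * q / Num.sqrt b') +
  (`|beta1 - beta2| + 1 - beta1) * (q * sigma / Num.sqrt (b' * (1 - beta2))).
Proof.
move=> q1 g1 s0 b0 /andP[b10 b14] /andP[b20 b21].
have sb0 : 0 < Num.sqrt b' by rewrite sqrtr_gt0.
have sb2 : 0 < Num.sqrt (b' * (1 - beta2)) by rewrite sqrtr_gt0 mulr_gt0// subr_gt0.
have sle : Num.sqrt (b' * (1 - beta2)) <= Num.sqrt b'.
  by rewrite ler_wsqrtr//; apply: ler_piMr; [exact: ltW|lra].
set x := sigma / Num.sqrt b'.
have x0 : 0 <= x by rewrite divr_ge0// ltW.
have xle : x <= sigma / Num.sqrt (b' * (1 - beta2)) by rewrite ler_wpM2l// lef_pV2.
have nle : 3 / 4 <= `|beta1 - beta2| + 1 - beta1.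
  by have := normr_ge0 (beta1 - beta2); lra.
have qx : x <= q * x by rewrite ler_peMl.
have h1 : q * x <= gamma * (q * x) by rewrite ler_peMl// mulr_ge0//; lra.
have h2 : 3 / 4 * (q * x) <= (`|beta1 - beta2| + 1 - beta1) *
    (q * (sigma / Num.sqrt (b' * (1 - beta2)))).
  by apply: ler_pM => //; [rewrite mulr_ge0//; lra|rewrite ler_wpM2l//; lra].
rewrite -!mulrA [sigma * (q / _)]mulrCA -/x; lra.
Qed.

(** This step size balances the initial gap against the smoothness term. With the roots of [Delta],
    [N] and [L * d] as variables, both equalities are field identities. *)
Lemma optimal_step (L d Delta N : R) :
  0 < L -> 0 < d -> 0 < Delta -> 0 < N ->
  Delta / (Num.sqrt (Delta / (L * d * N)) * N) = Num.sqrt (d * L * Delta) / Num.sqrt N /\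
  L * Num.sqrt (Delta / (L * d * N)) * d = Num.sqrt (d * L * Delta) / Num.sqrt N.
Proof.
move=> L0 d0 D0 N0.
have Ld0 : 0 < L * d by rewrite mulr_gt0.
have -> : Num.sqrt (d * L * Delta) = Num.sqrt Delta * Num.sqrt (L * d).
  by rewrite mulrC [d * L]mulrC sqrtrM// ltW.
have -> : Num.sqrt (Delta / (L * d * N)) = Num.sqrt Delta / (Num.sqrt (L * d) * Num.sqrt N).
  by rewrite sqrtrM ?ltW// sqrtrV ?ltW ?mulr_gt0// (sqrtrM N (ltW Ld0)).
have eD := sqr_sqrtr (ltW D0); have eN := sqr_sqrtr (ltW N0); have eL := sqr_sqrtr (ltW Ld0).
move: D0 N0 Ld0; rewrite -(sqrtr_gt0 Delta) -(sqrtr_gt0 N) -(sqrtr_gt0 (L * d)).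
move: (Num.sqrt Delta) (Num.sqrt N) (Num.sqrt (L * d)) eD eN eL => x z y eD eN eL x0 z0 y0.
split.
  by rewrite -eD -eN; field; rewrite !gt_eqF.
by rewrite mulrAC -eL; field; rewrite !gt_eqF.
Qed.
End parameters.

Theorem theorem3p3 (R : realType) :
  (exists C : R, 0 < C /\
    forall (m n r p b : nat) (f : 'M[R]_(m, n) -> R)
      (L sigma alpha beta1 beta2 : R) (W1 : 'M[R]_(m, n))
      (dX : measure_display) (X : measurableType dX) (D : probability X R)
      (G : 'M[R]_(m, n) -> X -> 'M[R]_(m, n))
      (dT : measure_display) (T : measurableType dT) (P : probability T R)
      (Z : mlorc_vars (R := R) T X m n r p b),
      let d : R := (m * n)%:R in
      let gamma : R := rsvd_gamma r p in
      (1 <= m)%N -> (1 <= n)%N ->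
      0 < L -> smooth_bounded_below f L ->
      0 <= sigma -> stochastic_gradient f D G sigma ->
      (2 <= r)%N -> (2 <= p)%N -> (r + p <= minn m n)%N ->
      0 < alpha -> (1 <= b)%N ->
      0 <= beta1 <= 1 / (4 * gamma * Num.sqrt d) ->
      0 <= beta2 < 1 ->
      is_mlorc_lion P D G W1 alpha beta1 beta2 Z ->
      forall N : nat, (1 <= N)%N ->
        (avg_grad_norm P f (iter_W Z) N <=
         C%:E *
         ('E_P[fun w => (f (iter_W Z 1 w) - f (iter_W Z N.+1 w))%R]
            * ((alpha * N%:R)^-1)%:E
          + (sigma * Num.sqrt d / (Num.sqrt b%:R * N%:R * (1 - beta2))
             + 2 * L * alpha * beta1 * d / (1 - beta2)
             + d * L * alpha
             + gamma * (sigma * Num.sqrt d / Num.sqrt b%:R)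
             + (`|beta1 - beta2| + 1 - beta1)
               * (Num.sqrt d * sigma / Num.sqrt (b%:R * (1 - beta2))))%:E))%E)
  /\
  (forall Gamma K : R, exists C : R, 0 < C /\
    forall (m n r p b : nat) (f : 'M[R]_(m, n) -> R)
      (L sigma alpha beta1 beta2 : R) (W1 : 'M[R]_(m, n))
      (dX : measure_display) (X : measurableType dX) (D : probability X R)
      (G : 'M[R]_(m, n) -> X -> 'M[R]_(m, n))
      (dT : measure_display) (T : measurableType dT) (P : probability T R)
      (Z : mlorc_vars (R := R) T X m n r p b),
      let d : R := (m * n)%:R in
      let gamma : R := rsvd_gamma r p in
      let Delta : R := f W1 - inf (range f) in
      (1 <= m)%N -> (1 <= n)%N ->
      0 < L -> smooth_bounded_below f L ->
      0 <= sigma -> stochastic_gradient f D G sigma ->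
      (2 <= r)%N -> (2 <= p)%N -> (r + p <= minn m n)%N ->
      0 < alpha -> (1 <= b)%N ->
      0 <= beta1 <= 1 / (4 * gamma * Num.sqrt d) ->
      0 <= beta2 < 1 ->
      is_mlorc_lion P D G W1 alpha beta1 beta2 Z ->
      0 < Delta -> gamma <= Gamma -> 1 / (1 - beta2) <= K ->
      forall N : nat, (1 <= N)%N ->
        alpha = Num.sqrt (Delta / (L * d * N%:R)) ->
        (avg_grad_norm P f (iter_W Z) N <=
         (C * (Num.sqrt (d * L * Delta) / Num.sqrt N%:R
               + sigma * Num.sqrt d / Num.sqrt b%:R))%:E)%E).
Proof.
split.
  (* 3 is the factor in [mlorc_lion_avg_le]. The decrease of [f], possibly negative, carries exactly
     this factor on both sides; what else the bracket contains is nonnegative and covers the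
     smoothness and noise terms. *)
  exists 3; split => // m n r p b f L sigma alpha beta1 beta2 W1 dX X D G dT T P Z d gamma.
  move=> m1 n1 L0 sf s0 SG r2 p2 rp a0 b0 hb1 hb2 ML N N0.
  have [q1 b14 b1d] := lion_parameters m1 n1 p2 hb1.
  have b11 : 0 <= beta1 < 1 by case/andP: hb1 => -> _ /=; lra.
  have b14' : 0 <= beta1 <= 1 / 4 by case/andP: hb1 => ->.
  have [a [e [-> /has_mean_expectation -> ale]]] :=
    mlorc_lion_avg_le (ltW L0) sf s0 SG a0 b0 b11 hb2 b1d ML N0.
  rewrite -(EFinM e) -EFinD -EFinM lee_fin; apply: le_trans ale _.
  have b0' : 0 < b%:R :> R by rewrite ltr0n.
  have N0' : 0 < N%:R :> R by rewrite ltr0n.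
  have := noise_coefficient_le q1 (@rsvd_gamma_ge1 R r p p2) s0 b0' b14' hb2.
  case/andP: hb2 => b20 b21; have b2' : 0 < 1 - beta2 by rewrite subr_gt0.
  have d0 : 0 <= d by exact: ler0n.
  have t1 : 0 <= sigma * Num.sqrt d / (Num.sqrt b%:R * N%:R * (1 - beta2)).
    by rewrite divr_ge0// ?mulr_ge0 ?sqrtr_ge0// ltW.
  have t2 : 0 <= 2 * L * alpha * beta1 * d / (1 - beta2).
    by case/andP: hb1 => b10 _; rewrite divr_ge0// ?mulr_ge0// ltW.
  have t3 : 0 <= d * L * alpha by rewrite !mulr_ge0// ltW.
  rewrite -/gamma -/d; lra.
(* The first summand needs 3 (1 + 1/2) by the balanced step, the second 3 (1 + 2/3) because the root
   of [d] is at least 1; 9 exceeds both. *)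
move=> Gamma K; exists 9; split => // m n r p b f L sigma alpha beta1 beta2 W1 dX X D G dT T P Z.
move=> d gamma Delta m1 n1 L0 sf s0 SG r2 p2 rp a0 b0 hb1 hb2 ML Delta0 _ _ N N0 alphaE.
have [q1 b14 b1d] := lion_parameters m1 n1 p2 hb1.
have b11 : 0 <= beta1 < 1 by case/andP: hb1 => -> _ /=; lra.
have [a [e [-> he ale]]] := mlorc_lion_avg_le (ltW L0) sf s0 SG a0 b0 b11 hb2 b1d ML N0.
rewrite lee_fin; apply: le_trans ale _.
have b0' : 0 < b%:R :> R by rewrite ltr0n.
have N0' : 0 < N%:R :> R by rewrite ltr0n.
have d0 : 0 < d by rewrite ltr0n muln_gt0 m1.
(* The first iterate is the constant [W1], and every value of [f] is at least the infimum. *)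
have eD : e <= Delta.
  apply: (has_mean_le he (has_mean_cst P Delta)) => w /=; rewrite (ml_init_W ML) lerD2l lerN2.
  by apply: ge_inf; [case: sf|exists (iter_W Z N.+1 w)].
have eDN : e / (alpha * N%:R) <= Delta / (alpha * N%:R).
  by rewrite ler_pM2r// invr_gt0 mulr_gt0.
have [h1 h2] := optimal_step L0 d0 Delta0 N0'; rewrite -alphaE in h1 h2.
rewrite h1 in eDN.
have x0 : 0 <= sigma / Num.sqrt b%:R by rewrite divr_ge0 ?sqrtr_ge0.
have xq : sigma / Num.sqrt b%:R <= sigma * Num.sqrt d / Num.sqrt b%:R.
  by rewrite mulrAC ler_peMr.
have y0 : 0 <= Num.sqrt (d * L * Delta) / Num.sqrt N%:R by rewrite divr_ge0 ?sqrtr_ge0.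
by rewrite -/d; lra.
Qed.
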